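(* Let $\Gamma_1$ and $\Gamma_2$ be loopless graphs on $n_1$ and $n_2$ vertices, respectively, and let $\Gamma_1\vee\Gamma_2$ denote their join. Write $z_i = X^{-n_i}$ for $i=1,2$. Then \[ W^-_{\Gamma_1\vee \Gamma_2}(X,T) = \frac{z_1 z_2 XT - 1 + W^-_{\Gamma_1}(X,z_2T)(1-z_2T)(1-z_2XT) + W^-_{\Gamma_2}(X,z_1T)(1-z_1T)(1-z_1XT)}{(1-T)(1-XT)}. \]
   Context: Graphs are finite, may have loops (edges $\{v\}$) but no parallel edges; $\sim$ denotes adjacency. The join $\Gamma_1\vee\Gamma_2$ is the disjoint union of $\Gamma_1$ and $\Gamma_2$ together with an edge joining each vertex of $\Gamma_1$ to each vertex of $\Gamma_2$. A compact DVR $\mathfrak O$ has maximal ideal $\mathfrak P$ and finite residue field of size $q$. For a matrix $A(X_1,\dots,X_\ell)\in \mathrm{Mat}_{n\times m}(\mathfrak O[X_1,\dots,X_\ell])$ of linear forms, its ask zeta function is $\mathsf Z^{\mathrm{ask}}_{A/\mathfrak O}(T)=\sum_{k\ge0}\alpha_kT^k$, where $\alpha_k$ is the average of $|\ker A(x)|$ over $x\in(\mathfrak O/\mathfrak P^k)^\ell$, with $A(x)$ acting as the map $(\mathfrak O/\mathfrak P^k)^n\to(\mathfrak O/\mathfrak P^k)^m$ by right multiplication on rows. For a graph $\Gamma$ with vertices $v_1,\dots,v_n$, $\mathsf A^-_\Gamma=[X_{ij}]$ is the $n\times n$ matrix of linear forms over $\mathbf Z$ with $X_{ij}=0$ iff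 $v_i\not\sim v_j$, $X_{ji}=-X_{ij}$ for $i\ne j$, and the nonzero $X_{ij}$ with $i\le j$ algebraically independent variables. $W^-_\Gamma(X,T)\in\mathbf Q(X,T)$ denotes the (known to exist, unique) rational function with $\mathsf Z^{\mathrm{ask}}_{\mathsf A^-_\Gamma/\mathfrak O}(T)=W^-_\Gamma(q,T)$ for every compact DVR $\mathfrak O$ with residue field size $q$. *)

(* Defs.v *)
From HB Require Import structures.
From mathcomp Require Import all_boot all_order all_algebra finmap.
From mathcomp Require Import all_classical topology.

Set Implicit Arguments.
Unset Strict Implicit.
Unset Printing Implicit Defensive.

Import Order.TTheory GRing.Theory Num.Theory.

Local Open Scope classical_set_scope.
Local Open Scope ring_scope.
Local Open Scope quotient_scope.

(* The quotient ring R / aR.  It is only a comPzRingType because a may be a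
   unit, in which case R / aR is the zero ring. *)
Section Residue.
Variables (R : comNzRingType) (a : R).

Definition multiples : {pred R} := fun y => `[< exists c, y = a * c >].

Lemma multiplesP y : reflect (exists c, y = a * c) (y \in multiples).
Proof. exact: asboolP. Qed.

Lemma multiples_zmod_closed : zmod_closed multiples.
Proof.
split=> [|_ _ /multiplesP[c ->] /multiplesP[d ->]]; apply/multiplesP.
  by exists 0; rewrite mulr0.
by exists (c - d); rewrite mulrBr.
Qed.

HB.instance Definition _ := GRing.isZmodClosed.Build R multiples
  multiples_zmod_closed.

Lemma multiplesMr x y : x \in multiples -> x * y \in multiples.
Proof.
by move=> /multiplesP[c ->]; apply/multiplesP; exists (c * y); rewrite mulrA.
Qed.

Definition residue := Quotient.quot multiples.

HB.instance Definition _ := GRing.Zmodule.on residue.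
HB.instance Definition _ := EqQuotient.on residue.

Definition residue_one : residue := \pi_residue 1.
Definition residue_mul (x y : residue) : residue := \pi_residue (repr x * repr y).

Lemma residue_eqP x y :
  reflect (\pi_residue x = \pi_residue y) (x - y \in multiples).
Proof. by rewrite Quotient.idealrBE; apply/eqP. Qed.

Lemma pi_residueD x y :
  \pi_residue (x + y) = \pi_residue x + \pi_residue y.
Proof. exact: Quotient.pi_add. Qed.

Lemma pi_residueM x y :
  residue_mul (\pi_residue x) (\pi_residue y) = \pi_residue (x * y).
Proof.
have rE z : repr (\pi_residue z) - z \in multiples.
  by apply/residue_eqP; rewrite reprK.
apply/residue_eqP; set x' := repr _; set y' := repr _.
rewrite (_ : x' * y' - x * y = (x' - x) * y' + (y' - y) * x); last first.
  by rewrite !mulrBl addrA (mulrC x y') subrK (mulrC y x).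
by rewrite rpredD ?multiplesMr ?rE.
Qed.

Fact residue_mulA : associative residue_mul.
Proof.
elim/quotW=> x; elim/quotW=> y; elim/quotW=> z.
by rewrite (pi_residueM y z) (pi_residueM x y) !pi_residueM mulrA.
Qed.

Fact residue_mulC : commutative residue_mul.
Proof. by elim/quotW=> x; elim/quotW=> y; rewrite !pi_residueM mulrC. Qed.

Fact residue_mul1 : left_id residue_one residue_mul.
Proof. by elim/quotW=> x; rewrite pi_residueM mul1r. Qed.

Fact residue_mulDl : left_distributive residue_mul +%R.
Proof.
elim/quotW=> x; elim/quotW=> y; elim/quotW=> z.
rewrite (pi_residueM x z) (pi_residueM y z) -!pi_residueD pi_residueM.
by rewrite mulrDl.
Qed.

HB.instance Definition _ := GRing.Zmodule_isComPzRing.Build residue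
  residue_mulA residue_mulC residue_mul1 residue_mulDl.

End Residue.

(* The carrier of R with the aR-adic topology. *)
Definition adic (R : comNzRingType) (a : R) : Type := R.

Section Adic.
Variables (R : comNzRingType) (a : R).
Local Notation adic := (adic a).

HB.instance Definition _ := Choice.copy adic R.

Definition adic_nbhs (x : adic) : set_system adic :=
  [set A | exists k : nat, forall c : R, A ((x : R) + a ^+ k * c)].

HB.instance Definition _ := hasNbhs.Build adic adic_nbhs.

Fact adic_nbhs_filter (x : adic) : ProperFilter (nbhs x).
Proof.
split; first by move=> [k /(_ 0)].
split=> [|A B [k Ak] [l Bl]|A B AB [k Ak]].
- by exists 0.
- exists (k + l)%N => c; split.
    by rewrite exprD -mulrA; exact: Ak.
  by rewrite addnC exprD -mulrA; exact: Bl.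
- by exists k => c; exact/AB/Ak.
Qed.

Fact adic_nbhs_singleton (x : adic) (A : set adic) : nbhs x A -> A x.
Proof. by move=> [k /(_ 0)]; rewrite mulr0 addr0. Qed.

Fact adic_nbhs_nbhs (x : adic) (A : set adic) :
  nbhs x A -> nbhs x (nbhs^~ A).
Proof.
by move=> [k Ak]; exists k => c; exists k => d; rewrite -addrA -mulrDr.
Qed.

HB.instance Definition _ := Nbhs_isNbhsTopological.Build adic
  adic_nbhs_filter adic_nbhs_singleton adic_nbhs_nbhs.

End Adic.

(* O is a principal ideal domain whose nonunits form the nonzero ideal pi O,
   i.e., a discrete valuation ring with maximal ideal P = pi O; the powers of
   P are then the ideals pi^k O. *)
Definition is_dvr (O : idomainType) (pi : O) : Prop :=
  [/\ forall I : {pred O}, idealr_closed I -> exists a, I =i multiples a,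
      pi != 0 &
      forall x : O, (x \isn't a GRing.unit) = (x \in multiples pi)].

Definition is_compact_dvr (O : idomainType) (pi : O) : Prop :=
  is_dvr pi /\ compact [set: adic pi].

(* A matrix of linear forms in variables X_e, e : E, is given by the matrices
   of coefficients of the X_e: its (i, j) entry is \sum_e (A e i j) X_e. *)
Definition linmx (R : Type) (E : finType) (n m : nat) := E -> 'M[R]_(n, m).

Section Ask.
Variables (O : comNzRingType) (E : finType) (n m : nat).
Variables (A : linmx O E n m) (a : O).

Definition linmx_eval (x : {ffun E -> residue a}) : 'M[residue a]_(n, m) :=
  \matrix_(i, j) \sum_e \pi_(residue a) (A e i j) * x e.

Definition ker_card (x : {ffun E -> residue a}) : nat :=
  #|` fset_set [set v : 'rV[residue a]_n | v *m linmx_eval x = 0] |.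

(* The average of the size of ker A(x), for x in (O / aO)^E; this is
   meaningful when O / aO is finite. *)
Definition ask : rat :=
  (\sum_(x \in [set: {ffun E -> residue a}]) ((ker_card x)%:R : rat))
  / (#|` fset_set [set: {ffun E -> residue a}] |)%:R.

End Ask.

(* The coefficients of the ask zeta function of A / O, where pi O is the
   maximal ideal of O. *)
Definition ask_zeta (O : comNzRingType) (pi : O) (E : finType) (n m : nat)
    (A : linmx O E n m) : nat -> rat :=
  fun k => ask A (pi ^+ k).

(* Q[X, T] = Q[X][T] and its fraction field Q(X, T). *)
Definition polyXT := {poly {poly rat}}.
Definition ratXT := {fraction {poly {poly rat}}}.

Definition fX : ratXT := FracField.tofrac ('X%:P : polyXT).
Definition fT : ratXT := FracField.tofrac ('X : polyXT).

Definition evalXT (p : polyXT) (x t : ratXT) : ratXT :=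
  (map_poly (fun c : {poly rat} => (map_poly ratr c).[x]) p).[t].

(* W(x, t), for x and t algebraically independent over Q; it then does not
   depend on the chosen numerator and denominator of W. *)
Definition substXT (W : ratXT) (x t : ratXT) : ratXT :=
  evalXT \n_(repr W) x t / evalXT \d_(repr W) x t.

(* W(q, T) = \sum_k alpha_k T^k.  Equivalently, X - q does not divide the
   denominator of W in lowest terms, and the rational function W(q, T) in Q(T)
   has power series expansion alpha. *)
Definition expansion_at (W : ratXT) (q : nat) (alpha : nat -> rat) : Prop :=
  exists N D : polyXT,
    let Nq := map_poly (horner_eval q%:R) N : {poly rat} in
    let Dq := map_poly (horner_eval q%:R) D : {poly rat} in
    [/\ W = FracField.tofrac N / FracField.tofrac D,
        Dq != 0 &
        forall k : nat, Nq`_k = \sum_(i < k.+1) Dq`_i * alpha (k - i)%N].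

(* Graphs on the vertices 0, ..., n - 1; loops are allowed. *)
Record graph (n : nat) := Graph {
  adj :> rel 'I_n;
  adj_sym : symmetric adj
}.

Definition loopless n (G : graph n) : Prop := irreflexive G.

Section Join.
Variables (n1 n2 : nat) (G1 : graph n1) (G2 : graph n2).

Definition join_adj : rel 'I_(n1 + n2) := fun u v =>
  match fintype.split u, fintype.split v with
  | inl i, inl j => G1 i j
  | inr i, inr j => G2 i j
  | _, _ => true
  end.

Fact join_adj_sym : symmetric join_adj.
Proof.
move=> u v; rewrite /join_adj.
by case: fintype.split => i; case: fintype.split => j //; exact: adj_sym.
Qed.

Definition graph_join : graph (n1 + n2) := Graph join_adj_sym.

End Join.

Definition edge n (G : graph n) : finType :=
  {e : 'I_n * 'I_n | (e.1 <= e.2)%N && G e.1 e.2}.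

Definition Aminus n (G : graph n) : linmx int (edge G) n n := fun e =>
  \matrix_(i, j) if (i, j) == val e then 1
                 else if (j, i) == val e then -1 else 0.
Arguments Aminus {n} G e.

Definition Aminus_over (O : comNzRingType) n (G : graph n) :
  linmx O (edge G) n n := fun e => map_mx intr (Aminus G e).
Arguments Aminus_over O {n} G e.

Definition represents_ask_minus n (G : graph n) (W : ratXT) : Prop :=
  forall (O : idomainType) (pi : O), is_compact_dvr pi ->
    expansion_at W #|` fset_set [set: residue pi] |
      (ask_zeta pi (Aminus_over O G)).

(* W is the rational function W^-_G. *)
Definition is_Wminus n (G : graph n) (W : ratXT) : Prop :=
  unique (represents_ask_minus G) W.

(* Main.v *)
Require Import Defs.
From HB Require Import structures.
From mathcomp Require Import all_boot all_order all_algebra.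
From mathcomp Require Import ring lra.

(* Exchanging the order of summation, the k-th coefficient of the ask zeta
   function is the sum over v in (O / pi^k)^n of 1 / |I(v)|, where
   I(v) = {v S : S alternating, S supported on the edges of the graph}.
   Multiplying the zeta function by 1 - T leaves only primitive v (those with a
   unit coordinate).  On a join, let v1 be primitive and let v2 generate the
   ideal (pi^m).  The projection of I(v1, v2) to the second coordinates is
   onto, and its kernel is I(v1) + pi^m K, where K = {w : w v1^T = 0} is a free
   direct summand of rank n1 - 1 containing I(v1); reduction modulo pi^m then
   expresses |I(v1, v2)| through |I(v1 mod pi^m)|.  Summing over v1 and v2
   gives a convolution of the primitive coefficients of the two graphs with
   geometric sequences, which is the stated identity.

   Uniqueness for the join is inherited from G1: if V and V' both represent the
   join, then W1 + (V - V') represents G1, and hence V = V'.  In particular no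
   compact DVR needs to be constructed. *)

Set Implicit Arguments.
Unset Strict Implicit.
Unset Printing Implicit Defensive.

Import Order.TTheory GRing.Theory Num.Theory.
Local Open Scope ring_scope.

(** * Expansions of rational functions *)

(** Relates the representatives through which [substXT] is defined to quotients of embedded
    polynomials. *)
Lemma frac_numden (R : idomainType) (x : {fraction R}) :
  x = FracField.tofrac \n_(repr x) / FracField.tofrac \d_(repr x).
Proof.
have d0 := denom_ratioP (repr x).
apply/(canRL (mulfK _)); first by rewrite tofrac_eq0.
rewrite -{1}[x]reprK; set r := repr x in d0 *; unlock FracField.tofrac.
rewrite -[LHS]FracField.pi_mul; apply/eqmodP; rewrite /= FracField.equivfE.
by rewrite /FracField.mulf !numden_Ratio ?mulf_neq0 ?oner_eq0 // !mulr1 mulrC.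
Qed.

Local Notation toF := (@FracField.tofrac {poly {poly rat}}).

Definition spec (q : nat) : polyXT -> {poly rat} :=
  map_poly (horner_eval q%:R).

HB.instance Definition _ q := GRing.RMorphism.on (spec q).

(** The coefficients of the product of [p] with the power series whose coefficients are [alpha]. *)
Definition conv (p : {poly rat}) (alpha : nat -> rat) (k : nat) : rat :=
  \sum_(i < k.+1) p`_i * alpha (k - i)%N.

Definition shift (alpha : nat -> rat) (k : nat) : rat :=
  if k is l.+1 then alpha l else 0.

(** Truncating the sequence to a polynomial lets [conv] inherit its algebra from polynomial
    multiplication. *)
Lemma conv_poly p alpha K k : (k < K)%N ->
  conv p alpha k = (p * \poly_(i < K) alpha i)`_k.
Proof.
move=> kK; rewrite coefM; apply: eq_bigr => i _.
by rewrite coef_poly (leq_ltn_trans (leq_subr _ _) kK).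
Qed.

Lemma eq_conv p alpha beta : alpha =1 beta -> conv p alpha =1 conv p beta.
Proof. by move=> e k; apply: eq_bigr => i _; rewrite e. Qed.

Lemma convM p p' alpha k : conv (p * p') alpha k = conv p (conv p' alpha) k.
Proof.
rewrite (conv_poly _ _ (leqnn _)) -mulrA coefM; apply: eq_bigr => i _.
by rewrite -conv_poly // ltnS leq_subr.
Qed.

Lemma conv_comm p p' alpha k : conv p (conv p' alpha) k = conv p' (conv p alpha) k.
Proof. by rewrite -!convM mulrC. Qed.

Lemma convD p p' alpha k : conv (p + p') alpha k = conv p alpha k + conv p' alpha k.
Proof. by rewrite !(conv_poly _ _ (leqnn _)) mulrDl coefD. Qed.

Lemma convN p alpha k : conv (- p) alpha k = - conv p alpha k.
Proof. by rewrite !(conv_poly _ _ (leqnn _)) mulNr coefN. Qed.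

Lemma conv_add p alpha beta k :
  conv p (fun i => alpha i + beta i) k = conv p alpha k + conv p beta k.
Proof. by rewrite -big_split; apply: eq_bigr => i _; rewrite mulrDr. Qed.

Lemma convC c alpha k : conv c%:P alpha k = c * alpha k.
Proof. by rewrite (conv_poly _ _ (leqnn _)) coefCM coef_poly leqnn. Qed.

Lemma conv1 alpha k : conv 1 alpha k = alpha k.
Proof. by rewrite -[X in conv X]/(1%:P) convC mul1r. Qed.

Lemma convX alpha k : conv 'X alpha k = shift alpha k.
Proof.
rewrite (conv_poly _ _ (leqnn _)) coefXM coef_poly.
by case: k => //= k; rewrite ltnS leqnSn.
Qed.

Lemma specX q : spec q 'X = 'X. Proof. exact: map_polyX. Qed.

Lemma specC q c : spec q c%:P = c.[q%:R]%:P. Proof. exact: map_polyC. Qed.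

Lemma coef0_neq0 (p : {poly rat}) : p`_0 != 0 -> p != 0.
Proof. by apply: contraNneq => ->; rewrite coef0. Qed.

Section Expansion.
Variable q : nat.
Implicit Types (W : ratXT) (alpha : nat -> rat).

Lemma expansionP W alpha : expansion_at W q alpha <->
  exists N D : polyXT, [/\ W = toF N / toF D, spec q D != 0 &
    forall k, (spec q N)`_k = conv (spec q D) alpha k].
Proof. by []. Qed.

Lemma spec_neq0 D : spec q D != 0 -> toF D != 0.
Proof. by apply: contraNneq => /eqP; rewrite tofrac_eq0 => /eqP ->; rewrite rmorph0. Qed.

Lemma eq_expansion W alpha beta : alpha =1 beta ->
  expansion_at W q alpha -> expansion_at W q beta.
Proof.
move=> e [N [D [WE D0 ND]]]; apply/expansionP; exists N, D; split=> // k.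
by rewrite -(eq_conv _ e) ND.
Qed.

Lemma expansionD W V alpha beta :
  expansion_at W q alpha -> expansion_at V q beta ->
  expansion_at (W + V) q (fun k => alpha k + beta k).
Proof.
move=> /expansionP[N [D [-> D0 ND]]] /expansionP[N' [D' [-> D'0 ND']]].
apply/expansionP; exists (N * D' + N' * D), (D * D'); split.
- by rewrite addf_div ?spec_neq0 // -!tofracM -tofracD.
- by rewrite rmorphM mulf_neq0.
- move=> k; rewrite rmorphD !rmorphM /= coefD conv_add convM conv_comm.
  rewrite convM [spec q N * _]mulrC [spec q N' * _]mulrC !coefM.
  by congr (_ + _); apply: eq_bigr => i _; rewrite (ND, ND').
Qed.

Lemma expansionM p W alpha : expansion_at W q alpha ->
  expansion_at (toF p * W) q (conv (spec q p) alpha).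
Proof.
move=> /expansionP[N [D [-> D0 ND]]]; apply/expansionP; exists (p * N), D.
split=> // [|k]; first by rewrite tofracM mulrA.
rewrite rmorphM /= conv_comm coefM; apply: eq_bigr => i _; by rewrite ND.
Qed.

(** With the denominator multiplied by [p], the defining equation for W / p and [alpha] becomes the
    one for W and [conv (spec q p) alpha]. *)
Lemma expansionV p W alpha beta : spec q p != 0 ->
  conv (spec q p) alpha =1 beta -> expansion_at W q beta ->
  expansion_at (W / toF p) q alpha.
Proof.
move=> p0 e /expansionP[N [D [-> D0 ND]]]; apply/expansionP.
exists N, (D * p); split=> [||k]; first by rewrite tofracM invfM mulrA.
  by rewrite rmorphM mulf_neq0.
by rewrite rmorphM convM ND -(eq_conv _ e).
Qed.

Lemma expansionN W alpha : expansion_at W q alpha ->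
  expansion_at (- W) q (fun k => - alpha k).
Proof.
move=> /(expansionM (-1)); rewrite rmorphN rmorph1 mulN1r; apply: eq_expansion.
by move=> k; rewrite rmorphN rmorph1 convN conv1.
Qed.

Lemma expansion1 : expansion_at 1 q (fun k => (k == 0%N)%:R).
Proof.
apply/expansionP; exists 1, 1; rewrite rmorph1 divr1 rmorph1 oner_eq0.
by split=> // k; rewrite conv1 coef1.
Qed.

Lemma expansionT W alpha : expansion_at W q alpha ->
  expansion_at (fT * W) q (shift alpha).
Proof.
by move=> /(expansionM 'X); apply: eq_expansion => k; rewrite specX convX.
Qed.

Lemma expansionX W alpha : expansion_at W q alpha ->
  expansion_at (fX * W) q (fun k => q%:R * alpha k).
Proof.
move=> /(expansionM 'X%:P); apply: eq_expansion => k.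
by rewrite specC convC hornerX.
Qed.

Lemma expansionXV n W alpha : (0 < q)%N -> expansion_at W q alpha ->
  expansion_at (fX ^- n * W) q (fun k => q%:R ^- n * alpha k).
Proof.
move=> q0 EW; have qn0 : (q%:R ^+ n : rat) != 0.
  by rewrite expf_neq0 // pnatr_eq0 -lt0n.
rewrite mulrC -tofracXn; apply: (expansionV (beta := alpha)) => //.
  by rewrite -rmorphXn specC hornerXn polyC_eq0.
by move=> k; rewrite -rmorphXn specC hornerXn convC mulVKf.
Qed.

Lemma expansion_div1T W alpha :
  expansion_at W q (fun k => alpha k - shift alpha k) ->
  expansion_at (W / (1 - fT)) q alpha.
Proof.
rewrite -(rmorph1 toF) -tofracB; apply: expansionV.
  (* The specialised denominator has constant term 1, so it is nonzero for every [q]. *)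
  rewrite rmorphB rmorph1 /= specX; apply: coef0_neq0.
  by rewrite coefB coef1 coefX subr0 oner_eq0.
by move=> k; rewrite rmorphB rmorph1 /= specX convD convN convX conv1.
Qed.

Lemma expansion_div1XT W alpha :
  expansion_at W q (fun k => alpha k - q%:R * shift alpha k) ->
  expansion_at (W / (1 - fX * fT)) q alpha.
Proof.
rewrite -(rmorph1 toF) -tofracM -tofracB; apply: expansionV.
  rewrite rmorphB rmorph1 rmorphM /= specX specC hornerX.
  by apply: coef0_neq0; rewrite coefB coef1 coefCM coefX mulr0 subr0 oner_eq0.
move=> k; rewrite rmorphB rmorph1 rmorphM /= specX specC hornerX convD convN convM.
by rewrite !convC convX mul1r.
Qed.

End Expansion.

(** * Substitution of X^-n T for T *)

Section Substitution.
Variable n : nat.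

(* [X ^ (n d) p(X, X ^ -n T)], a polynomial when p has T-degree at most d. *)
Definition scaleT (d : nat) (p : polyXT) : polyXT :=
  \poly_(i < d) (p`_i * 'X^(n * (d - i))).

Lemma scaleT_eq0 d (p : polyXT) : (size p <= d)%N ->
  (scaleT d p == 0) = (p == 0).
Proof.
move=> pd; apply/eqP/eqP => [p0|->]; apply/polyP => i; last first.
  by rewrite coef_poly !coef0 mul0r if_same.
have := congr1 (fun r : polyXT => r`_i) p0; rewrite coef_poly !coef0; case: ltnP => id.
  by move/eqP; rewrite mulf_eq0 expf_eq0 polyX_eq0 andbF orbF => /eqP.
by move=> _; rewrite nth_default // (leq_trans pd).
Qed.

Lemma ratr_frac (c : rat) : ratr c = toF (c%:P%:P : polyXT).
Proof.
have -> : toF (c%:P%:P : polyXT) = (toF \o polyC \o polyC) c by [].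
rewrite -{2}[c]divq_num_den fmorph_div /= /ratr.
by rewrite !(rmorph_int polyC) !(rmorph_int toF).
Qed.

Lemma evalXT_inner (c : {poly rat}) :
  (map_poly ratr c).[fX] = toF (c%:P : polyXT).
Proof.
rewrite horner_poly -[c in RHS]coefK poly_def !rmorph_sum /=.
apply: eq_bigr => i _; rewrite ratr_frac -mul_polyC !rmorphM !rmorphXn /=.
by [].
Qed.

(** With X kept fixed, [evalXT] is evaluation of a polynomial transported by a ring morphism; this
    makes it multiplicative. *)
Lemma evalXTE (p : polyXT) t : evalXT p fX t = (map_poly (toF \o polyC) p).[t].
Proof.
by congr (_.[_]); apply: eq_map_poly => c; exact: evalXT_inner.
Qed.

Lemma evalXTM (p p' : polyXT) t : evalXT (p * p') fX t = evalXT p fX t * evalXT p' fX t.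
Proof. by rewrite !evalXTE rmorphM hornerM. Qed.

Lemma fX_neq0 : fX != 0.
Proof. by rewrite tofrac_eq0 polyC_eq0 polyX_eq0. Qed.

Lemma evalXT_scale d (p : polyXT) : (size p <= d)%N ->
  evalXT p fX (fX ^- n * fT) = toF (scaleT d p) / fX ^+ (n * d).
Proof.
move=> pd; apply: (canRL (mulfK _)); first by rewrite expf_neq0 ?fX_neq0.
rewrite evalXTE (@horner_coef_wide _ d); last exact: leq_trans (size_poly _ _) pd.
rewrite mulr_suml /scaleT poly_def rmorph_sum; apply: eq_bigr => i _ /=.
rewrite coef_map_id0 ?rmorph0 //= -mul_polyC polyCM !rmorphM !rmorphXn /=.
rewrite -/fX -/fT -!mulrA; congr (_ * _); rewrite exprMn -mulrA mulrCA.
rewrite [RHS]mulrC; congr (_ * _).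
have -> : (n * d = n * i + n * (d - i))%N by rewrite -mulnDr subnKC // ltnW.
by rewrite exprD exprVn -exprM mulKf // expf_neq0 ?fX_neq0.
Qed.

Lemma evalXT_eq0 (p : polyXT) : (evalXT p fX (fX ^- n * fT) == 0) = (p == 0).
Proof.
rewrite (evalXT_scale (leqnn _)) mulf_eq0 invr_eq0 expf_eq0 (negPf fX_neq0).
by rewrite andbF orbF tofrac_eq0 scaleT_eq0.
Qed.

(** Two fractions representing W are related by cross-multiplication. Evaluation is multiplicative
    and does not vanish on nonzero polynomials, so the relation survives it. *)
Lemma substXT_frac N D : D != 0 ->
  substXT (toF N / toF D) fX (fX ^- n * fT) =
  evalXT N fX (fX ^- n * fT) / evalXT D fX (fX ^- n * fT).
Proof.
move=> D0; rewrite /substXT; set W := toF N / toF D.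
have d0 : \d_(repr W) != 0 := denom_ratioP _.
apply/eqP; rewrite eqr_div ?evalXT_eq0 // -!evalXTM.
apply/eqP; congr (evalXT _ _ _); apply/eqP; rewrite -tofrac_eq !tofracM.
by rewrite -eqr_div ?tofrac_eq0 // -frac_numden.
Qed.

Lemma spec_scaleT q d (p : polyXT) i : (i < d)%N ->
  (spec q (scaleT d p))`_i = (spec q p)`_i * (q%:R ^+ (n * (d - i))).
Proof.
move=> id; rewrite !coef_map_id0 ?horner_eval_is_linear //; try exact: horner0.
by rewrite coef_poly id /horner_eval hornerM hornerXn.
Qed.

Lemma expansion_subst q W alpha : (0 < q)%N -> expansion_at W q alpha ->
  expansion_at (substXT W fX (fX ^- n * fT)) q
    (fun k => (q%:R ^- n) ^+ k * alpha k).
Proof.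
move=> q0 /expansionP[N [D [-> D0 ND]]].
have qn0 m : (q%:R ^+ m : rat) != 0 by rewrite expf_neq0 // pnatr_eq0 -lt0n.
have DN0 : D != 0 by apply: contraNneq D0 => ->; rewrite rmorph0.
(* A common degree bound makes the factor X^(n d) the same above and below, so that it cancels. *)
rewrite substXT_frac //; set d := maxn (size N) (size D).
have [dN dD] : (size N <= d /\ size D <= d)%N by rewrite leq_maxl leq_maxr.
rewrite !(evalXT_scale (d := d)) //.
apply/expansionP; exists (scaleT d N), (scaleT d D).
have gen (p : polyXT) i : (size p <= d)%N -> (spec q (scaleT d p))`_i
   = q%:R ^+ (n * d) * ((q%:R ^- n) ^+ i * (spec q p)`_i).
  move=> pd; case: (ltnP i d) => id.
    rewrite spec_scaleT // mulrCA mulrC mulrA; congr (_ * _).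
    have -> : (n * d = n * i + n * (d - i))%N by rewrite -mulnDr subnKC // ltnW.
    by rewrite exprD exprVn -exprM mulKf.
  have pi : (size (spec q p) <= i)%N.
    exact: leq_trans (size_poly _ _) (leq_trans pd id).
  rewrite [in RHS]nth_default // !mulr0 nth_default //.
  exact: leq_trans (size_poly _ _) (leq_trans (size_poly _ _) id).
split.
- by rewrite -mulf_div divff ?mulr1 // invr_eq0 expf_eq0 (negPf fX_neq0) andbF.
- apply: contraNneq D0 => sD0; apply/eqP/polyP => i; rewrite coef0.
  apply/eqP; have := congr1 (fun p : {poly rat} => p`_i) sD0; rewrite gen // coef0 => /eqP.
  rewrite mulf_eq0 (negPf (qn0 _)) mulf_eq0 expf_eq0 invr_eq0 (negPf (qn0 _)).
  by rewrite andbF.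
- move=> k; rewrite gen // ND /conv !mulr_sumr; apply: eq_bigr => i _.
  rewrite gen //; have ik : (i <= k)%N by rewrite -ltnS.
  rewrite -[in X in _ * (X * _)](subnKC ik) exprD mulrACA; exact: mulrA.
Qed.

End Substitution.

Definition dif (alpha : nat -> rat) (k : nat) : rat := alpha k - shift alpha k.

(** * The join identity read off coefficient by coefficient *)

Section JoinExpansion.
Variables (q n1 n2 : nat) (W1 W2 : ratXT) (a a1 a2 : nat -> rat).
Hypothesis q0 : (0 < q)%N.
Hypotheses (EW1 : expansion_at W1 q a1) (EW2 : expansion_at W2 q a2).
Let z1 : rat := q%:R ^- n1.
Let z2 : rat := q%:R ^- n2.
Hypotheses (a0 : a 0 = 1) (a10 : a1 0 = 1) (a20 : a2 0 = 1).
(** Coefficients of T and T^(k+2) in the join identity after multiplication by (1 - T)(1 - XT). The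
    product q (1 - z1) (1 - z2) collects the term z1 z2 X T and the degree one contributions of the
    three constant coefficients. *)
Hypothesis a_1 : dif a 1 =
  z2 * dif a1 1 + z1 * dif a2 1 + q%:R * (1 - z1) * (1 - z2).
Hypothesis a_rec : forall k, dif a k.+2 = q%:R * dif a k.+1
  + z2 ^+ k.+2 * (dif a1 k.+2 - q%:R * dif a1 k.+1)
  + z1 ^+ k.+2 * (dif a2 k.+2 - q%:R * dif a2 k.+1).

Lemma expansion_summand n W alpha : expansion_at W q alpha ->
  let z : rat := q%:R ^- n in
  let u k := z ^+ k * dif alpha k in
  expansion_at (substXT W fX (fX ^- n * fT) * (1 - fX ^- n * fT)
                * (1 - fX ^- n * fX * fT)) q
    (fun k => u k - z * (q%:R * shift u k)).
Proof.
move=> EW z u; set V := _ * (1 - _ ^- _ * fT).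
have EV : expansion_at V q u.
  rewrite /V; set s := substXT _ _ _; rewrite mulrBr mulr1 (mulrC s) -mulrA.
  apply: eq_expansion (expansionD (expansion_subst n q0 EW) (expansionN
    (expansionXV n q0 (expansionT (expansion_subst n q0 EW))))) => k.
  rewrite /u /dif; case: k => [|k] /=; first by rewrite mulr0 !subr0.
  by rewrite -/z exprS; ring.
rewrite mulrBr mulr1 [V * _]mulrC -!mulrA.
exact: expansionD EV (expansionN (expansionXV n q0 (expansionX (expansionT EV)))).
Qed.

Lemma expansion_join :
  let Z1 : ratXT := fX ^- n1 in
  let Z2 : ratXT := fX ^- n2 in
  expansion_at
    ((Z1 * Z2 * fX * fT - 1
      + substXT W1 fX (Z2 * fT) * (1 - Z2 * fT) * (1 - Z2 * fX * fT)
      + substXT W2 fX (Z1 * fT) * (1 - Z1 * fT) * (1 - Z1 * fX * fT))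
     / ((1 - fT) * (1 - fX * fT))) q a.
Proof.
move=> Z1 Z2; rewrite invfM mulrA; apply/expansion_div1XT/expansion_div1T.
apply: eq_expansion; last first.
  apply: expansionD (expansion_summand n1 EW2).
  apply: expansionD (expansion_summand n2 EW1).
  apply: expansionD (expansionN (expansion1 q)).
  rewrite -(mulr1 fT) -!mulrA; apply/(expansionXV _ q0)/(expansionXV _ q0).
  exact/expansionX/expansionT/expansion1.
(* The polynomial part z1 z2 X T - 1 lives in degrees 0 and 1; from degree 2 on only the recursion
   is left. *)
move=> [|[|k]]; rewrite -/z1 -/z2 /=.
- by rewrite /dif /= a0 a10 a20; ring.
- by move: a_1; rewrite /dif /= a0 a10 a20 => e; lra.
- by move: (a_rec k); rewrite /dif /= => e; rewrite !(exprS _ k.+1); move: e; rewrite !exprS; lra.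
Qed.

End JoinExpansion.

(** * Transfer of uniqueness between graphs *)

Lemma expansion_uniq_shift (W V V' : ratXT) q alpha beta :
  expansion_at W q alpha -> expansion_at V q beta -> expansion_at V' q beta ->
  expansion_at (W + (V - V')) q alpha.
Proof.
move=> EW EV EV'; apply: eq_expansion (expansionD EW (expansionD EV (expansionN EV'))).
by move=> k /=; rewrite subrr addr0.
Qed.

Lemma is_Wminus_uniq n m (G : graph n) (H : graph m) W V :
  is_Wminus G W -> represents_ask_minus H V -> is_Wminus H V.
Proof.
move=> [EW uW] EV; split=> // V' EV'.
suff /eqP : W = W + (V - V').
  by rewrite -subr_eq0 opprD addNKr oppr_eq0 subr_eq0 => /eqP.
apply: uW => O pi Opi.
exact: expansion_uniq_shift (EW _ _ Opi) (EV _ _ Opi) (EV' _ _ Opi).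
Qed.

(** * Spans of alternating matrices over finite rings *)

Lemma sub_morph0 (U V : zmodType) (f : U -> V) :
  {morph f : x y / x - y} -> f 0 = 0.
Proof. by move=> fB; rewrite -[0 in LHS](subrr 0) fB subrr. Qed.

Section FiniteFibres.
Variables (U V : finZmodType) (A : {set U}) (f : U -> V).
Hypothesis fB : {morph f : x y / x - y}.
Hypothesis AB : {in A &, forall x y, x - y \in A}.

Lemma card_fibre x0 : x0 \in A ->
  #|[set x in A | f x == f x0]| = #|[set x in A | f x == 0]|.
Proof.
move=> Ax0; have A0 : 0 \in A by rewrite -(subrr x0) AB.
have AN : - x0 \in A by rewrite -sub0r AB.
rewrite -(card_imset _ (addIr (- x0))); apply: eq_card => y.
apply/imsetP/idP => [[x]|].
  by rewrite !inE => /andP[Ax /eqP fx] ->; rewrite AB // fB fx subrr eqxx.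
rewrite inE => /andP[Ay /eqP fy]; exists (y + x0); last by rewrite addrK.
rewrite inE -[in y + x0](opprK x0) AB //= -[- x0]sub0r !fB fy.
by rewrite (sub_morph0 fB) !sub0r opprK.
Qed.

(** All nonempty fibres of an additive map on a subgroup are translates of its kernel. *)
Lemma card_image_ker : #|A| = (#|f @: A| * #|[set x in A | f x == 0%R]|)%N.
Proof.
rewrite -sum1_card (partition_big_imset f) /=.
rewrite (eq_bigr (fun=> #|[set x in A | f x == 0]|)) ?sum_nat_const //.
move=> y /imsetP[x0 Ax0 ->]; rewrite sum1dep_card -(card_fibre Ax0).
by apply: eq_card => x; rewrite !inE.
Qed.

End FiniteFibres.

(** [t] is its part above the diagonal minus the transpose of that part. The zero diagonal is
    assumed separately because 2 may be a zero divisor. *)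
Lemma sum_antisym (R : zmodType) n (t : 'I_n -> 'I_n -> R) :
  (forall i, t i i = 0) -> (forall i j, t i j = - t j i) ->
  \sum_i \sum_j t i j = 0.
Proof.
move=> t0 tN; pose u (i j : 'I_n) := if (i < j)%N then t i j else 0.
have tE i j : t i j = u i j - u j i.
  rewrite /u tN; case: ltngtP => [_|_|/val_inj ->]; first by rewrite subr0 -tN.
    by rewrite sub0r.
  by rewrite t0 subr0 oppr0.
under eq_bigr => i _ do under eq_bigr => j _ do rewrite tE.
under eq_bigr => i _ do rewrite sumrB.
by rewrite sumrB [X in _ - X]exchange_big subrr.
Qed.


(** For a loopless graph the support condition forces a zero diagonal, so these skew-symmetric
    matrices are alternating in every characteristic. *)
Definition alt (R : finComPzRingType) n (G : graph n) : {set 'M[R]_n} :=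
  [set S : 'M[R]_n | (S^T == - S) && [forall i, forall j, ~~ G i j ==> (S i j == 0)]].
Arguments alt R {n} G.

Section Alt.
Variables (R : finComPzRingType) (n : nat) (G : graph n).

Lemma alt_mxP (S : 'M[R]_n) :
  reflect (S^T = - S /\ forall i j, ~~ G i j -> S i j = 0) (S \in alt R G).
Proof.
rewrite inE; apply: (iffP andP) => [[/eqP St /forallP S0]|[-> S0]]; split=> //.
  by move=> i j Gij; have /forallP/(_ j)/implyP/(_ Gij)/eqP := S0 i.
by apply/forallP => i; apply/forallP => j; apply/implyP => /S0 ->.
Qed.

Lemma altB : {in alt R G &, forall S S', S - S' \in alt R G}.
Proof.
move=> S S' /alt_mxP[St S0] /alt_mxP[St' S0']; apply/alt_mxP; split.
  by rewrite linearB /= St St' opprB opprK addrC.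
by move=> i j Gij; rewrite !mxE S0 // S0' // subr0.
Qed.

Lemma alt0 : 0 \in alt R G.
Proof. by apply/alt_mxP; split=> [|i j _]; rewrite ?trmx0 ?oppr0 ?mxE. Qed.

(** The terms v_k S_kl v_l are antisymmetric with zero diagonal. This places I(v) inside the
    orthogonal complement of v. *)
Lemma alt_isotropic (v : 'rV[R]_n) S : loopless G -> S \in alt R G ->
  v *m S *m v^T = 0.
Proof.
move=> Gl /alt_mxP[St S0]; apply/matrixP => i j; rewrite !mxE.
under eq_bigr => k _ do rewrite !mxE mulr_suml.
have SN k l : S k l = - S l k by rewrite -[in LHS](opprK S) -St !mxE.
rewrite !ord1; apply: sum_antisym => [k|k l].
  by rewrite S0 ?Gl // mulr0 mul0r.
by rewrite [in LHS]SN mulrN mulNr; congr (- _); rewrite mulrC mulrA mulrAC.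
Qed.

(** The additive group I(v). *)
Definition altspan (v : 'rV[R]_n) : {set 'rV[R]_n} :=
  [set v *m S | S : 'M_n in alt R G].

Lemma altspanB v : {in altspan v &, forall x y, x - y \in altspan v}.
Proof.
move=> _ _ /imsetP[S aS ->] /imsetP[S' aS' ->]; rewrite -mulmxBr.
by apply/imsetP; exists (S - S'); rewrite ?altB.
Qed.

Lemma altspan0 v : 0 \in altspan v.
Proof. by apply/imsetP; exists 0; rewrite ?alt0 ?mulmx0. Qed.

End Alt.
Arguments altspan {R n} G v.

Section AltMap.
Variables (R S : finComPzRingType) (rho : {rmorphism R -> S}).
Hypothesis rho_surj : forall y, exists x, rho x = y.
Variables (n : nat) (G : graph n).

Lemma alt_map (M : 'M[R]_n) : M \in alt R G -> map_mx rho M \in alt S G.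
Proof.
move=> /alt_mxP[Mt M0]; apply/alt_mxP; split=> [|i j Gij].
  by rewrite map_trmx Mt map_mxN.
by rewrite mxE M0 // rmorph0.
Qed.

Lemma map_mx_surj m p (N : 'M[S]_(m, p)) : exists M : 'M[R]_(m, p), map_mx rho M = N.
Proof.
have rho' y : {x | rho x = y}.
  have e : exists x, rho x == y by have [x <-] := rho_surj y; exists x.
  by exists (xchoose e); apply/eqP/(xchooseP e).
exists (\matrix_(i, j) sval (rho' (N i j))).
by apply/matrixP => i j; rewrite !mxE; case: rho'.
Qed.

Lemma alt_lift (N : 'M[S]_n) : loopless G -> N \in alt S G ->
  exists2 M, M \in alt R G & map_mx rho M = N.
Proof.
move=> Gl /alt_mxP[Nt N0]; have NN i j : N i j = - N j i.
  by rewrite -[in LHS](opprK N) -Nt !mxE.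
have [M MN] := map_mx_surj N.
have Mij i j : rho (M i j) = N i j by rewrite -MN mxE.
(* An arbitrary lift need not be skew-symmetric: its entries above the diagonal are kept and those
   below are determined by them. *)
pose M' := \matrix_(i, j)
  (if G i j then if (i < j)%N then M i j else - M j i else 0).
exists M'.
  apply/alt_mxP; split=> [|i j /negPf Gij]; last by rewrite mxE Gij.
  apply/matrixP => i j; rewrite !mxE adj_sym.
  case: ifP => Gij; last by rewrite oppr0.
  case: ltngtP => // [_|/val_inj ij]; first by rewrite opprK.
  by rewrite ij Gl in Gij.
apply/matrixP => i j; rewrite !mxE.
case: ifPn => Gij; last by rewrite rmorph0 N0.
by case: ifP => _; rewrite ?rmorphN Mij -?NN.
Qed.

Lemma altspan_map (v : 'rV[R]_n) : loopless G ->
  altspan G (map_mx rho v) = map_mx rho @: altspan G v.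
Proof.
move=> Gl; apply/setP => w; apply/imsetP/imsetP => [[N aN ->]|[_ /imsetP[M aM ->] ->]].
  have [M aM <-] := alt_lift Gl aN.
  by exists (v *m M); rewrite ?map_mxM //; apply/imsetP; exists M.
by exists (map_mx rho M); rewrite ?alt_map ?map_mxM.
Qed.

(** Multiplication by [c] factors through [rho] followed by an injection, so c I(v) is in bijection
    with the image of I(v) under [rho]. It serves to identify nonprimitive vectors with vectors one
    level lower. *)
Lemma card_altspan_scale (c : R) (iota : S -> R) (v : 'rV[R]_n) :
  loopless G -> injective iota -> (forall x, iota (rho x) = c * x) ->
  #|altspan G (c *: v)| = #|altspan G (map_mx rho v)|.
Proof.
move=> Gl inj_iota iotaE; rewrite altspan_map //.
have inj_map : injective (map_mx iota : 'rV[S]_n -> 'rV[R]_n).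
  move=> x y /matrixP xy; apply/matrixP => i j.
  by apply: inj_iota; have := xy i j; rewrite !mxE.
rewrite -(card_imset _ inj_map) -imset_comp; apply: eq_card => x.
suff -> : altspan G (c *: v) = [set map_mx iota (map_mx rho w) | w in altspan G v] by [].
have iE w : map_mx iota (map_mx rho w) = c *: w :> 'rV_n.
  by apply/matrixP => i j; rewrite !mxE.
rewrite /altspan -imset_comp; apply: eq_imset => M /=.
by rewrite iE scalemxAl.
Qed.

End AltMap.

Lemma card_rowset (T : finType) n (X : {set T}) :
  #|[set w : 'rV[T]_n | [forall j, w 0 j \in X]]| = (#|X| ^ n)%N.
Proof.
rewrite -[n in RHS]card_ord -card_ffun_on.
have inj : injective (fun f : {ffun 'I_n -> T} => \row_j f j).
  by move=> f g /rowP fg; apply/ffunP => j; have := fg j; rewrite !mxE.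
rewrite -(card_imset _ inj); apply: eq_card => w; rewrite inE.
apply/forallP/imsetP => [wX|[f /ffun_onP fX ->] j]; last by rewrite mxE.
exists [ffun j => w 0 j]; last by apply/rowP => j; rewrite mxE ffunE.
by apply/ffun_onP => j; rewrite ffunE.
Qed.

(** * Primitive vectors and their orthogonal complements *)

Section Primitive.
Variables (R : finComPzRingType) (n : nat).
Implicit Types v w : 'rV[R]_n.

(** The witness [u] splits off the line spanned by [v], which is the form used below; over a residue
    ring of positive level it amounts to a unit coordinate. *)
Definition primitive v := [exists u : 'cV[R]_n, v *m u == 1%:M].

Lemma primitiveP v : reflect (exists u : 'cV[R]_n, v *m u = 1%:M) (primitive v).
Proof. by apply: (iffP existsP) => -[u /eqP vu]; exists u. Qed.

Definition perp v : {set 'rV[R]_n} := [set w | w *m v^T == 0].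

Definition multset (c : R) : {set R} := [set c * x | x : R].

Definition cperp (c : R) v : {set 'rV[R]_n} := [set c *: w | w : 'rV_n in perp v].

Lemma perpB v : {in perp v &, forall x y, x - y \in perp v}.
Proof.
by move=> x y; rewrite !inE mulmxBl => /eqP-> /eqP->; rewrite subrr.
Qed.

Lemma perpZ v c w : w \in perp v -> c *: w \in perp v.
Proof. by rewrite !inE -scalemxAl => /eqP->; rewrite scaler0. Qed.

(** With K the complement of v, this is c K = K ∩ c R^n. If w = c y lies in K, the component (y v^T)
    u^T of y is killed by c, and removing it from y gives an element of K. *)
Lemma cperpP c v w : primitive v ->
  reflect (w \in perp v /\ exists y, w = c *: y) (w \in cperp c v).
Proof.
move=> pv; apply: (iffP imsetP) => [[y yv ->]|[]].
  by split; [exact: perpZ|exists y].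
have /primitiveP[u vu] := pv; rewrite inE => /eqP wv [y yw]; exists (y - y *m v^T *m u^T).
  by rewrite inE mulmxBl -(mulmxA _ u^T) -trmx_mul vu trmx1 mulmx1 subrr.
by rewrite scalerBr !scalemxAl -yw wv mul0mx subr0.
Qed.

Lemma rowset_multP c w :
  reflect (exists y, w = c *: y) [forall j, w 0 j \in multset c].
Proof.
apply: (iffP forallP) => [wc|[y ->] j]; last first.
  by rewrite mxE; apply/imsetP; exists (y 0 j).
have wc' j : exists x, w 0 j == c * x.
  by have /imsetP[x _ ->] := wc j; exists x.
exists (\row_j xchoose (wc' j)); apply/rowP => j; rewrite !mxE.
exact/eqP/(xchooseP (wc' j)).
Qed.

(** The map w -> w v^T sends c R^n onto c R, and its kernel there is c K. *)
Lemma card_cperp c v : primitive v ->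
  (#|cperp c v| * #|multset c| = #|multset c| ^ n)%N.
Proof.
move=> pv; have /primitiveP[u vu] := pv.
pose A := [set w : 'rV_n | [forall j, w 0 j \in multset c]].
have AP w : reflect (exists y, w = c *: y) (w \in A).
  by rewrite inE; exact: rowset_multP.
have fB : {morph (fun w : 'rV[R]_n => w *m v^T) : x y / x - y}.
  by move=> x y; rewrite mulmxBl.
have AB : {in A &, forall x y, x - y \in A}.
  move=> _ _ /AP[x ->] /AP[y ->]; apply/AP; exists (x - y).
  by rewrite scalerBr.
rewrite -card_rowset -/A (card_image_ker fB AB).
rewrite mulnC; congr (_ * _)%N; last first.
  apply: eq_card => w; rewrite [RHS]inE.
  apply/(cperpP _ _ pv)/andP; rewrite [w \in perp v]inE.
    by move=> [wv /AP Aw].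
  by move=> [/AP Aw wv].
have inj : injective (scalar_mx : R -> 'M_1).
  by move=> x y /matrixP/(_ 0 0); rewrite !mxE.
rewrite -(card_imset _ inj) -imset_comp; apply: eq_card => x.
apply/imsetP/imsetP => [[y _ ->]|[_ /AP[w ->] ->]] /=.
  exists (c *: (y *: u^T)); first by apply/AP; exists (y *: u^T).
  by rewrite -!scalemxAl -trmx_mul vu trmx1 scalerA scalemx1.
exists ((w *m v^T) 0 0) => //=; rewrite -scalemxAl -scale_scalar_mx.
by congr (_ *: _); exact: mx11_scalar.
Qed.

End Primitive.

(** * Reduction modulo an ideal generated by one element *)

Section Reduction.
Variables (R S : finComPzRingType) (rho : {rmorphism R -> S}) (c : R).
Hypothesis rho_surj : forall y, exists x, rho x = y.
Hypothesis rho_ker : forall x, rho x = 0 <-> exists y, x = c * y.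
Variable n : nat.

Lemma sum_map_rV (K : pzSemiRingType) (F : 'rV[S]_n -> K) :
  \sum_(v : 'rV[R]_n) F (map_mx rho v) =
  (#|multset c| ^ n)%:R * \sum_(w : 'rV[S]_n) F w.
Proof.
rewrite (partition_big (map_mx rho) predT) //= mulr_sumr; apply: eq_bigr => w _.
rewrite (eq_bigr (fun=> F w)) => [|v /eqP-> //].
rewrite sumr_const mulr_natl; congr (_ *+ _).
have [v0 <-] := map_mx_surj rho_surj w.
have -> : #|[pred v | map_mx rho v == map_mx rho v0]|
    = #|[set v in setT | map_mx rho v == map_mx rho v0]|.
  by apply: eq_card => v; rewrite !inE.
have fB : {morph (map_mx rho : 'rV_n -> 'rV_n) : x y / x - y}.
  by move=> x y; rewrite map_mxB.
rewrite (card_fibre fB) ?inE //; last by move=> x y _ _; rewrite inE.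
rewrite -card_rowset; apply: eq_card => v; rewrite !inE.
apply/eqP/forallP => [v0' j|vc].
  have /rho_ker[y vy] : rho (v 0 j) = 0.
    by have := congr1 (fun M : 'rV_n => M 0 j) v0'; rewrite !mxE.
  by apply/imsetP; exists y.
apply/rowP => j; rewrite !mxE; have /imsetP[y _ vy] := vc j.
by apply/rho_ker; exists y.
Qed.

(** Reduction maps I(v) + c K onto I of the reduced vector. The sum lies in K because I(v) does, so
    the kernel is K ∩ c R^n = c K, whose size is given by [card_cperp]. *)
Lemma card_altspan_cperp (G : graph n) (v : 'rV[R]_n) :
  loopless G -> primitive v ->
  (#|[set (w + k)%R | w in altspan G v, k in cperp c v]| * #|multset c| =
   #|multset c| ^ n * #|altspan G (map_mx rho v)|)%N.
Proof.
move=> Gl pv; set A := imset2 _ _ _.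
have rc0 (w : 'rV[R]_n) : map_mx rho (c *: w) = 0.
  by apply/rowP => j; rewrite !mxE; apply/rho_ker; exists (w 0 j).
have fB : {morph (map_mx rho : 'rV_n -> 'rV_n) : x y / x - y}.
  by move=> x y; rewrite map_mxB.
have AB : {in A &, forall x y, x - y \in A}.
  move=> _ _ /imset2P[x _ Ax /imsetP[k vk ->] ->] /imset2P[y _ Ay /imsetP[l vl ->] ->].
  rewrite opprD addrACA -scalerBr; apply/imset2P.
  exists (x - y) (c *: (k - l)); rewrite ?altspanB //.
  by apply/imsetP; exists (k - l); rewrite ?perpB.
rewrite (card_image_ker fB AB).
have -> : map_mx rho @: A = altspan G (map_mx rho v).
  rewrite altspan_map //; apply/setP => w; apply/imsetP/imsetP => -[].
    move=> _ /imset2P[x _ Ax /imsetP[k vk ->] ->] ->; exists x => //.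
    by rewrite map_mxD rc0 addr0.
  move=> x Ax ->; exists x => //; apply/imset2P; exists x 0; rewrite ?addr0 //.
  by apply/imsetP; exists 0; rewrite ?scaler0 ?inE ?mul0mx.
rewrite -(card_cperp c pv) -mulnA mulnC; congr (_ * _ * _)%N.
apply: eq_card => w; rewrite inE; apply/andP/(cperpP _ _ pv) => -[].
  move=> /imset2P[x _ /imsetP[M aM ->] /imsetP[k vk ->] ->] /eqP w0; split.
    rewrite inE mulmxDl (alt_isotropic _ Gl aM) add0r.
    by have := perpZ c vk; rewrite inE.
  have wc j : exists x, (v *m M + c *: k) 0 j == c * x.
    have /rho_ker[y ->] : rho ((v *m M + c *: k) 0 j) = 0; last by exists y.
    by have := congr1 (fun M : 'rV_n => M 0 j) w0; rewrite !mxE.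
  exists (\row_j xchoose (wc j)); apply/rowP => j; rewrite [RHS]mxE [X in _ * X]mxE.
  exact/eqP/(xchooseP (wc j)).
move=> wv [y wy]; split; last by rewrite wy rc0.
apply/imset2P; exists 0 w; rewrite ?add0r ?altspan0 //.
by apply/(cperpP _ _ pv); split=> //; exists y.
Qed.

End Reduction.

(** * Alternating spans on a join *)

Section JoinSpan.
Variables (R : finComPzRingType) (n1 n2 : nat) (G1 : graph n1) (G2 : graph n2).
Hypotheses (G1l : loopless G1) (G2l : loopless G2).

Lemma graph_join_loopless : loopless (graph_join G1 G2).
Proof. by move=> i; rewrite /= /join_adj; case: fintype.split. Qed.

Lemma alt_joinP (M : 'M[R]_(n1 + n2)) :
  reflect (exists S1 S2 B, [/\ S1 \in alt R G1, S2 \in alt R G2 &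
             M = block_mx S1 B (- B^T) S2])
          (M \in alt R (graph_join G1 G2)).
Proof.
apply: (iffP idP) => [|[S1 [S2 [B [/alt_mxP[S1t S10] /alt_mxP[S2t S20] ->]]]]].
  move=> /alt_mxP[Mt M0]; exists (ulsubmx M), (drsubmx M), (ursubmx M).
  have Me : M = block_mx (ulsubmx M) (ursubmx M) (dlsubmx M) (drsubmx M).
    by rewrite submxK.
  move: Mt; rewrite {1 2}Me tr_block_mx opp_block_mx => /eq_block_mx[ulE dlE urE drE].
  split.
  - apply/alt_mxP; split=> // i j Gij; rewrite !mxE M0 //=.
    by rewrite /join_adj !(unsplitK (inl _)).
  - apply/alt_mxP; split=> // i j Gij; rewrite !mxE M0 //=.
    by rewrite /join_adj !(unsplitK (inr _)).
  - by rewrite urE opprK -Me.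
apply/alt_mxP; split.
  by rewrite tr_block_mx opp_block_mx S1t S2t linearN /= trmxK opprK.
move=> i j; rewrite /= /join_adj /block_mx.
rewrite -[i]splitK -[j]splitK !unsplitK.
case: (fintype.split i) => i'; case: (fintype.split j) => j' //= Gij.
  by rewrite col_mxEu row_mxEl S10.
by rewrite col_mxEd row_mxEr S20.
Qed.

(** Counts image and kernel of the projection to the second block. The alternative c = 0 covers a
    zero second block. *)
Lemma card_altspan_join c (v1 : 'rV[R]_n1) (v2 : 'rV[R]_n2) :
  primitive v1 -> primitive v2 \/ c = 0 ->
  #|altspan (graph_join G1 G2) (row_mx v1 (c *: v2))| =
  (#|R| ^ n2 * #|[set (w + k)%R | w in altspan G1 v1, k in cperp c v1]|)%N.
Proof.
move=> pv1 v2c; have /primitiveP[u vu] := pv1.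
pose I := altspan (graph_join G1 G2) (row_mx v1 (c *: v2)).
have IP x y : reflect (exists S1 S2 B, [/\ S1 \in alt R G1, S2 \in alt R G2,
      x = v1 *m S1 - c *: v2 *m B^T & y = v1 *m B + c *: v2 *m S2])
    (row_mx x y \in I).
  apply: (iffP imsetP) => [[_ /alt_joinP[S1 [S2 [B [aS1 aS2 ->]]]]]|].
    rewrite mul_row_block mulmxN => /eq_row_mx[-> ->]; by exists S1, S2, B.
  move=> [S1 [S2 [B [aS1 aS2 -> ->]]]].
  exists (block_mx S1 B (- B^T) S2); last by rewrite mul_row_block mulmxN.
  by apply/alt_joinP; exists S1, S2, B.
have fB : {morph (rsubmx : 'rV_(n1 + n2) -> 'rV[R]_n2) : x y / x - y}.
  by move=> x y; rewrite linearB.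
rewrite -/I (card_image_ker fB (@altspanB _ _ _ _)).
congr (_ * _)%N.
  have -> : rsubmx @: I = [set: 'rV_n2].
    apply/setP => y; rewrite inE; apply/imsetP.
    (* Since v1 u = 1, the block B = u y already gives v1 B = y. *)
    exists (row_mx (- (c *: v2 *m (u *m y)^T)) y); last by rewrite row_mxKr.
    apply/IP; exists 0, 0, (u *m y); rewrite !alt0 !mulmx0 sub0r addr0.
    by rewrite mulmxA vu mul1mx.
  by rewrite cardsT card_mx mul1n.
have inj : injective (fun w : 'rV[R]_n1 => row_mx w (0 : 'rV[R]_n2)).
  by move=> x y /eq_row_mx[].
rewrite -(card_imset _ inj); apply: eq_card => x; rewrite inE.
rewrite -[x]hsubmxK row_mxKr; move: (lsubmx x) (rsubmx x) => {x} x y.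
apply/andP/imsetP => [[/IP[S1 [S2 [B [aS1 aS2 xE yE]]]] /eqP y0]|].
  (* [B0] is B corrected so that v1 B0 = 0; hence v2 B0^T is orthogonal to v1. *)
  rewrite y0; exists x => //; pose B0 := B - u *m (v1 *m B).
  have vB0 : v1 *m B0 = 0 by rewrite /B0 mulmxBr (mulmxA v1 u) vu mul1mx subrr.
  have BE : v1 *m B = - (c *: v2 *m S2) by apply/eqP; rewrite -addr_eq0 -yE y0.
  apply/imset2P; exists (v1 *m S1) (c *: - (v2 *m B0^T)).
  - by apply/imsetP; exists S1.
  - apply/imsetP; exists (- (v2 *m B0^T)) => //.
    by rewrite inE mulNmx -mulmxA -trmx_mul vB0 trmx0 mulmx0 oppr0.
  rewrite xE scalerN scalemxAl; congr (_ - _).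
  (* Passing from B to [B0] changes v2 B^T by a multiple of v2 S2 v2^T, which is 0. *)
  rewrite /B0 linearB /= mulmxBr BE mulmxN linearN /= mulmxN opprK.
  have /alt_mxP[S2t _] := aS2.
  rewrite 2!trmx_mul S2t !mulNmx mulmxN !mulmxA (alt_isotropic _ G2l aS2).
  by rewrite mul0mx oppr0 addr0.
move=> [_ /imset2P[_ _ /imsetP[S1 aS1 ->] /imsetP[k vk ->] ->]].
move=> /eq_row_mx[-> ->]; split=> //; apply/IP.
case: v2c => [/primitiveP[t vt]|->].
  (* With v2 t = 1, the block B = -(t k)^T contributes c k to the first coordinates, and v1 B = 0
     because k is orthogonal to v1. *)
  exists S1, 0, (- (t *m k)^T); rewrite aS1 alt0; split=> //.
    by rewrite linearN /= trmxK mulmxN opprK -scalemxAl mulmxA vt mul1mx.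
  rewrite mulmx0 addr0 mulmxN -[v1 in RHS]trmxK -trmx_mul -mulmxA.
  by move: vk; rewrite inE => /eqP ->; rewrite mulmx0 trmx0 oppr0.
exists S1, 0, 0; rewrite aS1 alt0 !scale0r !mulmx0 addr0 trmx0 mulmx0 subr0 addr0.
by split.
Qed.

End JoinSpan.

Lemma leq_card_altspan_swap (R : finComPzRingType) n1 n2 (G1 : graph n1)
    (G2 : graph n2) (v1 : 'rV[R]_n1) (v2 : 'rV[R]_n2) :
  (#|altspan (graph_join G1 G2) (row_mx v1 v2)|
   <= #|altspan (graph_join G2 G1) (row_mx v2 v1)|)%N.
Proof.
pose sw (x : 'rV[R]_(n1 + n2)) := row_mx (rsubmx x) (lsubmx x).
have inj : injective sw.
  by move=> x y /eq_row_mx[r l]; rewrite -[x]hsubmxK -[y]hsubmxK r l.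
rewrite -(card_imset _ inj); apply/subset_leq_card/subsetP => _ /imsetP[x + ->].
move=> /imsetP[_ /alt_joinP[S1 [S2 [B [aS1 aS2 ->]]]] ->].
apply/imsetP; exists (block_mx S2 (- B^T) B S1).
  by apply/alt_joinP; exists S2, S1, (- B^T); rewrite linearN /= trmxK opprK.
by rewrite /sw !mul_row_block row_mxKl row_mxKr addrC [X in row_mx _ X]addrC.
Qed.

(** Vectors whose second block alone is primitive can thus be treated in the join taken in the other
    order. *)
Lemma card_altspan_swap (R : finComPzRingType) n1 n2 (G1 : graph n1)
    (G2 : graph n2) (v1 : 'rV[R]_n1) (v2 : 'rV[R]_n2) :
  #|altspan (graph_join G1 G2) (row_mx v1 v2)| =
  #|altspan (graph_join G2 G1) (row_mx v2 v1)|.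
Proof. by apply/eqP; rewrite eqn_leq !leq_card_altspan_swap. Qed.

(* Imported only here because classical_sets shadows names of finset. *)
From mathcomp Require Import finmap.
From mathcomp Require Import all_classical topology.
Local Open Scope quotient_scope.

(** * Finite residue rings *)

(* compact_cover is only stated for pointed spaces. *)
HB.instance Definition _ (O : comNzRingType) (a : O) :=
  isPointed.Build (adic a) (0 : O).

(** The cosets of (a^k) form an open cover, and a finite subcover yields finitely many
    representatives. *)
Lemma compact_finite_residue (O : comNzRingType) (a : O) k :
  compact [set: adic a]%classic -> finite_set [set: residue (a ^+ k)]%classic.
Proof.
rewrite (@compact_cover (adic a)) => cO.
pose B (x : adic a) : set (adic a) :=
  [set y : adic a | exists c, (y : O) = (x : O) + a ^+ k * c]%classic.
have [|y _|D _ DO] := cO _ [set: adic a]%classic B.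
- move=> x _; rewrite openE => y [c yE]; exists k => d; exists (c + d).
  by rewrite yE mulrDr addrA.
- by exists y => //; exists 0; rewrite mulr0 addr0.
apply: (@sub_finite_set _ _
  ((fun x : adic a => \pi_(residue (a ^+ k)) (x : O)) @` [set` D])%classic).
  elim/quotW=> y _; have [x Dx [c yE]] := DO y I.
  exists x => //; apply/residue_eqP/multiplesP; exists (- c).
  by rewrite yE opprD addrA subrr add0r mulrN.
exact/finite_image/finite_fset.
Qed.

Section FiniteResidue.
Variables (O : comNzRingType) (a : O).
Hypothesis fin : finite_set [set: residue a]%classic.

Let elts : seq (residue a) := fset_set [set: residue a]%classic.

Lemma mem_elts x : x \in elts. Proof. by rewrite in_fset_set // in_setT. Qed.

Lemma elts_pickleK : pcancel (index^~ elts) (nth None (map Some elts)).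
Proof.
by move=> x; rewrite (nth_map x) ?index_mem ?nth_index ?mem_elts.
Qed.

Lemma elts_enumP : Finite.axiom elts.
Proof. by apply: Finite.uniq_enumP => [|x]; [exact: fset_uniq|exact: mem_elts]. Qed.

End FiniteResidue.

(* The finiteness proof is an argument of the type so that the finType
   structure can be inferred. *)
Definition finres (O : comNzRingType) (a : O)
  (fin : finite_set [set: residue a]%classic) : Type := residue a.
HB.instance Definition _ O a fin := GRing.ComPzRing.on (@finres O a fin).
HB.instance Definition _ O a fin :=
  Choice_isCountable.Build (@finres O a fin) (elts_pickleK fin).
HB.instance Definition _ O a fin := isFinite.Build (@finres O a fin) (elts_enumP fin).

Section Projection.
Variables (O : comNzRingType) (a : O).
Hypothesis fin : finite_set [set: residue a]%classic.

Definition resproj (x : O) : finres fin := \pi_(residue a) x.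

Lemma resprojB : {morph resproj : x y / x - y}.
Proof.
move=> x y; rewrite /resproj [LHS](pi_residueD a x (- y)); congr (_ + _).
exact: Quotient.pi_opp.
Qed.

Lemma resproj_monoid : monoid_morphism resproj.
Proof. by split=> // x y; rewrite /resproj -pi_residueM. Qed.

HB.instance Definition _ := GRing.isZmodMorphism.Build O (finres fin) resproj resprojB.
HB.instance Definition _ := GRing.isMonoidMorphism.Build O (finres fin) resproj resproj_monoid.

Lemma resproj_eqP x y : resproj x = resproj y <-> exists c, x - y = a * c.
Proof. by split=> [/residue_eqP/multiplesP//|xy]; apply/residue_eqP/multiplesP. Qed.

Lemma resproj_eq0P x : resproj x = 0 <-> exists c, x = a * c.
Proof. by rewrite -(rmorph0 resproj) resproj_eqP subr0. Qed.

Definition rlift (x : finres fin) : O := repr (x : residue a).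

Lemma rliftK x : resproj (rlift x) = x. Proof. exact: reprK. Qed.

End Projection.

(** * Cardinalities and sums over finite types *)

Section FinTypeTransfer.

Lemma card_fset_setT (T : finType) : #|` fset_set [set: T]%classic| = #|T|.
Proof.
rewrite cardE; apply/perm_size/uniq_perm; rewrite ?fset_uniq ?enum_uniq //.
by move=> x; rewrite in_fset_set ?mem_enum ?in_setT //; exact: finite_finset.
Qed.

Lemma card_fset_pred (T : finType) (P : pred T) :
  #|` fset_set [set x | P x]%classic| = #|P|.
Proof.
rewrite cardE; apply/perm_size/uniq_perm; rewrite ?fset_uniq ?enum_uniq //.
move=> x; rewrite in_fset_set ?mem_enum; last exact: finite_finset.
by apply/idP/idP => [/set_mem|Px]; [|apply/mem_set].
Qed.

Lemma fsum_finType (T : finType) (F : T -> rat) :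
  (\sum_(x \in [set: T]%classic) F x)%R = \sum_x F x.
Proof.
rewrite fsbig_finite; last exact: finite_finset.
apply: perm_big; apply: uniq_perm; rewrite ?index_enum_uniq ?fset_uniq //.
by move=> x; rewrite in_fset_set ?in_setT ?mem_index_enum //; exact: finite_finset.
Qed.

End FinTypeTransfer.

(** * Average kernel sizes as sums over vectors *)

Definition alpha (R : finComPzRingType) n (G : graph n) : rat :=
  \sum_(v : 'rV[R]_n) (#|altspan G v|)%:R^-1.

Definition alpha_prim (R : finComPzRingType) n (G : graph n) : rat :=
  \sum_(v : 'rV[R]_n | primitive v) (#|altspan G v|)%:R^-1.
Arguments alpha R {n} G.
Arguments alpha_prim R {n} G.

HB.instance Definition _ (E : finType) (R : finZmodType) := GRing.Zmodule.on {ffun E -> R}.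

Section AskAlpha.
Variables (O : comNzRingType) (a : O).
Hypothesis fin : finite_set [set: residue a]%classic.
Variables (n : nat) (G : graph n).
Hypothesis Gl : loopless G.
Let R : finComPzRingType := @finres O a fin.
Let E := edge G.

Let evalmx (x : {ffun E -> R}) : 'M[R]_n := linmx_eval (a := a) (Aminus_over O G) x.

Lemma evalmxE x i j : evalmx x i j = \sum_e
  (if (i, j) == val e then x e else if (j, i) == val e then - x e else 0).
Proof.
rewrite !mxE; apply: eq_bigr => e _; rewrite !mxE -/(resproj fin _).
case: ifP => _; first by rewrite !rmorph1 mul1r.
by case: ifP => _; rewrite ?rmorphN ?rmorph1 ?mulN1r // !rmorph0 mul0r.
Qed.

Lemma evalmxB : {morph evalmx : x y / x - y}.
Proof.
move=> x y; apply/matrixP => i j; rewrite [RHS]mxE [X in _ = _ + X]mxE !evalmxE -sumrN -big_split /=.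
apply: eq_bigr => e _; rewrite !ffunE.
by do 2?case: ifP => _ //; rewrite ?subr0 ?opprB ?opprK ?opprD 1?addrC.
Qed.

(** Each edge carries one free variable, read off above the diagonal. Without loops the positions
    (i, j) and (j, i) of an edge differ, so the two cases of [Aminus] never compete. *)
Lemma evalmx_alt : evalmx @: [set: {ffun E -> R}] = alt R G.
Proof.
have EG (e : E) : G (val e).1 (val e).2 by have /andP[] := valP e.
have Ele (e : E) : ((val e).1 <= (val e).2)%N by have /andP[] := valP e.
have En (e : E) : (val e).1 != (val e).2.
  by apply/eqP => e12; have := EG e; rewrite e12 Gl.
apply/setP => S; apply/imsetP/alt_mxP => [[x _ ->]|[St S0]].
  split=> [|i j /negPf Gij]; last first.
    rewrite evalmxE big1 // => e _; case: eqP => [ije|_].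
      by have := EG e; rewrite -ije /= Gij.
    by case: eqP => [jie|//]; have := EG e; rewrite -jie /= adj_sym Gij.
  apply/matrixP => i j; rewrite [LHS]mxE [RHS]mxE !evalmxE -sumrN; apply: eq_bigr => e _.
  case: eqP => [jie|_]; case: eqP => [ije|_]; rewrite ?oppr0 ?opprK //.
  by case/eqP: (En e); rewrite -ije; case: (etrans ije (esym jie)).
have SN i j : S i j = - S j i by rewrite -[in LHS](opprK S) -St !mxE.
exists [ffun e => S (val e).1 (val e).2] => //; apply/matrixP => i j.
(* Edges are stored with ordered endpoints; both sides are skew-symmetric, so entries with i <= j
   suffice. *)
wlog ij : i j / (i <= j)%N => [wl|].
  have [/wl//|/ltnW/wl ji] := leqP i j; rewrite SN ji !evalmxE -sumrN.
  apply: eq_bigr => e _.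
  case: eqP => [jie|_]; case: eqP => [ije|_]; rewrite ?oppr0 ?opprK //.
  by case/eqP: (En e); rewrite -ije; case: (etrans ije (esym jie)).
rewrite evalmxE; case: (boolP (G i j)) => Gij; last first.
  rewrite S0 // big1 // => e _; case: eqP => [ije|_].
    by have := EG e; rewrite -ije /= (negPf Gij).
  by case: eqP => [jie|//]; have := EG e; rewrite -jie /= adj_sym (negPf Gij).
have eP : (i <= j)%N && G i j by rewrite ij Gij.
pose e0 : E := exist _ (i, j) eP.
rewrite (bigD1 e0) //= eqxx ffunE big1 ?addr0 // => e ee0.
case: eqP => [ije|_]; first by case/eqP: ee0; apply: val_inj.
case: eqP => [jie|//]; have := Ele e; have := En e; rewrite -[val e]jie /= => ji.
by move=> ji'; case/eqP: ji; apply/val_inj/anti_leq; rewrite ij ji'.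
Qed.

(** For fixed v the map x -> v A(x) is additive with image I(v), so v is killed by a proportion 1 /
    |I(v)| of all x. *)
Lemma ask_alpha : ask (Aminus_over O G) a = alpha R G.
Proof.
rewrite /ask; set N := #|` _|.
have NE : N = #|{: {ffun E -> R}}| by rewrite -card_fset_setT.
have N0 : (N%:R : rat) != 0.
  by rewrite NE pnatr_eq0 -lt0n; apply/card_gt0P; exists 0.
have sumE : (\sum_(x \in [set: {ffun E -> R}]%classic)
      ((ker_card (Aminus_over O G) (x : {ffun E -> residue a}))%:R : rat))%R =
    \sum_(x : {ffun E -> R}) \sum_(v : 'rV[R]_n) (v *m evalmx x == 0)%:R :> rat.
  apply: etrans (fsum_finType _) _.
  apply: eq_bigr => x _; rewrite -natr_sum; congr (_%:R).
  transitivity #|(fun v : 'rV[R]_n => v *m evalmx x == 0) : pred _|.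
    rewrite -card_fset_pred; congr (#|` fset_set _|).
    by apply/seteqP; split=> v /eqP.
  by rewrite -sum1_card big_mkcond; apply: eq_bigr => v _; rewrite unfold_in; case: eqP.
apply: etrans (congr1 (fun s => s / N%:R) sumE) _.
rewrite exchange_big mulr_suml; apply: eq_bigr => v _ /=.
apply: (mulIf N0); rewrite divfK //.
have fB : {morph (fun x => v *m evalmx x) : x y / x - y}.
  by move=> x y; rewrite evalmxB mulmxBr.
have TB : {in [set: {ffun E -> R}] &, forall x y, x - y \in [set: {ffun E -> R}]}.
  by move=> x y _ _; rewrite inE.
have := card_image_ker fB TB; rewrite cardsT -NE => ->.
rewrite imset_comp evalmx_alt natrM mulKf; last first.
  by rewrite pnatr_eq0 -lt0n; apply/card_gt0P; exists 0; exact: altspan0.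
rewrite -natr_sum; congr (_%:R); rewrite -sum1_card [RHS]big_mkcond /=.
by apply: eq_bigr => x _; rewrite !inE; case: eqP.
Qed.

End AskAlpha.

(** * The tower of residue rings of a compact DVR *)

Lemma leq_expn n : {homo expn^~ n : a b / (a <= b)%N}.
Proof. by case: n => // n a b ab; rewrite leq_exp2r. Qed.

Section Reduction.
Variables (O : comNzRingType) (pi : O).
Hypothesis fin : forall k, finite_set [set: residue (pi ^+ k)]%classic.
Variables (k m : nat).
Hypothesis mk : (m <= k)%N.

(** The proof of m <= k is an argument of the map so that its morphism structure can be inferred. *)
Definition red of (m <= k)%N := fun x : finres (fin k) => resproj (fin m) (rlift x).

Lemma red_resproj x : red mk (resproj (fin k) x) = resproj (fin m) x.
Proof.
have /resproj_eqP[c e] := rliftK (resproj (fin k) x).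
apply/resproj_eqP; exists (pi ^+ (k - m) * c).
by rewrite e mulrA -exprD subnKC.
Qed.

Lemma redB : {morph red mk : x y / x - y}.
Proof.
move=> x y; rewrite -[x]rliftK -[y]rliftK -rmorphB !red_resproj.
exact: rmorphB.
Qed.

Lemma red_monoid : monoid_morphism (red mk).
Proof.
split=> [|x y]; first by rewrite -[X in red mk X](rmorph1 (resproj (fin k))) red_resproj rmorph1.
by rewrite -[x]rliftK -[y]rliftK -rmorphM !red_resproj -rmorphM.
Qed.

End Reduction.

Arguments red {O pi fin k m} mk x.
HB.instance Definition _ O pi fin k m mk := GRing.isZmodMorphism.Build
  (finres (fin k)) (finres (fin m)) (@red O pi fin k m mk) (@redB O pi fin k m mk).
HB.instance Definition _ O pi fin k m mk := GRing.isMonoidMorphism.Build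
  (finres (fin k)) (finres (fin m)) (@red O pi fin k m mk) (@red_monoid O pi fin k m mk).

Section Tower.
Variables (O : idomainType) (pi : O).
Hypothesis fin : forall k, finite_set [set: residue (pi ^+ k)]%classic.
Hypothesis pi0 : pi != 0.
Hypothesis unitE : forall x : O, (x \isn't a GRing.unit) = (x \in multiples pi).
Local Notation R k := (finres (fin k)).

Let q := #|{: R 1}|.

Definition unif k : R k := resproj (fin k) pi.

Lemma red_surj k m (mk : (m <= k)%N) (y : R m) : exists x : R k, red mk x = y.
Proof. by exists (resproj _ (rlift y)); rewrite red_resproj rliftK. Qed.

Lemma red_ker k m (mk : (m <= k)%N) (x : R k) :
  red mk x = 0 <-> exists y, x = unif k ^+ m * y.
Proof.
rewrite -[x]rliftK red_resproj; split=> [/resproj_eq0P[c ->]|[y xy]].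
  by exists (resproj _ c); rewrite rmorphM rmorphXn.
rewrite -(@red_resproj _ _ fin _ _ mk) xy rmorphM /= -rmorphXn /= red_resproj.
have -> : resproj (fin m) (pi ^+ m) = 0.
  by apply/resproj_eq0P; exists 1; rewrite mulr1.
by rewrite mul0r.
Qed.

(** Multiplication by pi as an embedding of O / pi^k into O / pi^(k+1); it is injective because O is
    a domain. *)
Definition up k (x : R k) : R k.+1 := resproj (fin k.+1) (pi * rlift x).

Lemma up_red k (x : R k.+1) : up (red (leqnSn k) x) = unif k.+1 * x.
Proof.
rewrite /up -[x in RHS]rliftK /unif -rmorphM; apply/resproj_eqP.
have /resproj_eqP[c e] := rliftK (red (leqnSn k) x).
by exists c; rewrite -mulrBr e exprS mulrA.
Qed.

Lemma up_inj k : injective (@up k).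
Proof.
move=> x y /resproj_eqP[c]; rewrite -mulrBr exprS -mulrA => /(mulfI pi0) e.
by rewrite -[x]rliftK -[y]rliftK; apply/resproj_eqP; exists c.
Qed.

Lemma R0_eq0 (x : R 0) : x = 0.
Proof. by rewrite -[x]rliftK; apply/resproj_eq0P; exists (rlift x); rewrite mul1r. Qed.

Lemma card_multset_red k m (mk : (m <= k)%N) :
  (#|{: R k}| = #|{: R m}| * #|multset (unif k ^+ m)|)%N.
Proof.
have TB : {in [set: R k] &, forall x y, x - y \in [set: R k]}.
  by move=> x y _ _; rewrite inE.
have := card_image_ker (@redB _ _ fin _ _ mk) TB; rewrite cardsT => ->; congr (_ * _)%N.
  rewrite -cardsT; apply: eq_card => y; rewrite inE; apply/imsetP.
  by have [x <-] := red_surj mk y; exists x.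
apply: eq_card => x; rewrite !inE; apply/eqP/imsetP => [/red_ker[y ->]|[y _ ->]].
  by exists y.
by apply/red_ker; exists y.
Qed.

(** The kernel of the map from level k+1 to level 1 consists of the multiples of pi, which [up]
    identifies with level k. *)
Lemma card_R k : #|{: R k}| = (q ^ k)%N.
Proof.
elim: k => [|k IHk].
  rewrite expn0 -(fintype.card1 (0 : R 0)); apply: eq_card => x.
  by rewrite (R0_eq0 x) !inE eqxx.
rewrite expnS -IHk (card_multset_red (ltn0Sn k)) [unif _ ^+ 1]expr1; congr (_ * _)%N.
rewrite -(card_imset _ (@up_inj k)); apply: eq_card => x.
apply/imsetP/imsetP => [[y _ ->]|[y _ ->]].
  by exists (red (leqnSn k) y); rewrite // up_red.
by have [z <-] := red_surj (leqnSn k) y; exists z; rewrite // up_red.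
Qed.

Lemma q_gt0 : (0 < q)%N. Proof. by apply/card_gt0P; exists 0. Qed.

Lemma card_multset k m : (m <= k)%N -> #|multset (unif k ^+ m)| = (q ^ (k - m))%N.
Proof.
move=> mk; have := card_multset_red mk; rewrite !card_R -{1}(subnKC mk) expnD.
by move/eqP; rewrite eqn_pmul2l ?expn_gt0 ?q_gt0 // => /eqP.
Qed.

Lemma primitive_or k n (v : 'rV[R k]_n) :
  primitive v \/ exists w, v = unif k *: w.
Proof.
case: (pselect (exists j, rlift (v 0 j) \is a GRing.unit)) => [[j vj]|nv].
  left; apply/primitiveP; exists (\col_i if i == j then resproj _ (rlift (v 0 j))^-1 else 0).
  apply/matrixP => a b; rewrite !ord1 !mxE (bigD1 j) //= !mxE eqxx big1 ?addr0.
    by rewrite -[v 0 j]rliftK -rmorphM rliftK mulrV // rmorph1.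
  by move=> i /negPf ij; rewrite !mxE ij mulr0.
right; have vE j : exists x, v 0 j == unif k * x.
  have : rlift (v 0 j) \in multiples pi.
    by rewrite -unitE; apply/negP => vj; apply: nv; exists j.
  move=> /multiplesP[c e]; exists (resproj _ c).
  by rewrite -[v 0 j]rliftK e rmorphM.
exists (\row_j xchoose (vE j)); apply/rowP => j; rewrite !mxE.
exact/eqP/(xchooseP (vE j)).
Qed.

(** Otherwise pi would divide 1. Level 0 is excluded because in the zero ring every vector is both
    primitive and a multiple of pi. *)
Lemma primitive_excl k n (v w : 'rV[R k]_n) : (0 < k)%N ->
  primitive v -> v <> unif k *: w.
Proof.
case: k v w => // k v w _ /primitiveP[u vu] vw.
have : unif k.+1 * (w *m u) 0 0 = 1.
  have := congr1 (fun M : 'M_1 => M 0 0) vu.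
  by rewrite vw -scalemxAl !mxE eqxx.
move: ((w *m u) 0 0) => x; rewrite -[x]rliftK -(rmorph1 (resproj (fin k.+1))) -rmorphM.
move=> /resproj_eqP[c]; move: (rlift x) => y; rewrite exprS => e.
have : 1 \in multiples pi.
  apply/multiplesP; exists (y - pi ^+ k * c).
  by rewrite mulrBr mulrA -e opprB addrCA subrr addr0.
by rewrite -unitE unitr1.
Qed.


Lemma unif_exp k : unif k ^+ k = 0.
Proof. by rewrite -rmorphXn; apply/resproj_eq0P; exists 1; rewrite mulr1. Qed.

Lemma red_unif k m (mk : (m <= k)%N) : red mk (unif k) = unif m.
Proof. exact: red_resproj. Qed.

(** * Filtration of vectors by powers of the uniformizer *)

Definition layer k n j : {set 'rV[R k]_n} :=
  [set v : 'rV[R k]_n | [forall i, v 0 i \in multset (unif k ^+ j)]].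

Lemma layerP k n j (v : 'rV[R k]_n) :
  reflect (exists w, v = unif k ^+ j *: w) (v \in layer k n j).
Proof. by rewrite inE; exact: rowset_multP. Qed.

Lemma card_layer k n j : (j <= k)%N -> #|layer k n j| = ((q ^ (k - j)) ^ n)%N.
Proof. by move=> jk; rewrite card_rowset card_multset. Qed.

Lemma primitive_layer k n (v : 'rV[R k]_n) : (0 < k)%N ->
  primitive v = (v \notin layer k n 1).
Proof.
move=> k0; apply/idP/idP => [pv|].
  by apply/layerP => -[w]; exact: primitive_excl.
by have [//|[w ->]] := primitive_or v => /layerP[]; exists w.
Qed.

Lemma layerS k n j (v : 'rV[R k]_n) : v \in layer k n j.+1 -> v \in layer k n j.
Proof.
by move=> /layerP[w ->]; apply/layerP; exists (unif k *: w); rewrite exprSr scalerA.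
Qed.

Lemma layer_primitive k n j (w : 'rV[R k]_n) :
  unif k ^+ j *: w \notin layer k n j.+1 -> primitive w.
Proof.
have [//|[w' ->]] := primitive_or w => /layerP[]; exists w'.
by rewrite scalerA exprSr.
Qed.

Local Notation qq := (q%:R : rat).

Lemma qq_neq0 j : qq ^+ j != 0.
Proof. by rewrite expf_neq0 // pnatr_eq0 -lt0n q_gt0. Qed.

(** F depends only on the exact power pi^m dividing the vector. For m < k there are q^((k-m) n) -
    q^((k-m-1) n) such vectors, and the last term is the zero vector. *)
Lemma sum_layer k n (F : 'rV[R k]_n -> rat) (h : nat -> rat) :
  (forall m w, (m < k)%N -> primitive w -> F (unif k ^+ m *: w) = h m) ->
  F 0 = h k ->
  forall j, (j <= k)%N -> \sum_(v in layer k n j) F v =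
    \sum_(j <= m < k) (1 - qq ^- n) * (qq ^+ (k - m)) ^+ n * h m + h k.
Proof.
(* Descending induction on j, run on k - j. *)
move=> Fh F0 j jk; rewrite -(subKn jk); move: (k - j)%N (leq_subr j k) => i ik {j jk}.
elim: i ik => [_|i IHi ik].
  rewrite subn0 big_geq // add0r -F0 (bigD1 0) /=; last first.
    by apply/layerP; exists 0; rewrite scaler0.
  rewrite big1 ?addr0 // => v /andP[/layerP[w ->]].
  by rewrite unif_exp scale0r eqxx.
set j := (k - i.+1)%N; have jS : (k - i = j.+1)%N by rewrite -subnSK.
have jk : (j < k)%N by rewrite -jS leq_subr.
rewrite (big_ltn jk) -addrA -jS -(IHi (ltnW ik)) jS.
rewrite (bigID (fun v => v \in layer k n j.+1)) /= addrC; congr (_ + _); last first.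
  apply: eq_bigl => v; apply/andP/idP => [[]//|vj].
  by rewrite vj (layerS vj).
rewrite (eq_bigr (fun=> h j)) => [|v /andP[/layerP[w ->] /layer_primitive pw]]; last first.
  exact: Fh.
rewrite (eq_bigl (mem (layer k n j :\: layer k n j.+1))) => [|v]; last first.
  by rewrite !inE andbC.
rewrite sumr_const cardsD.
have -> : layer k n j :&: layer k n j.+1 = layer k n j.+1.
  by apply/finset.setIidPr/fintype.subsetP => v; exact: layerS.
rewrite !card_layer // 1?ltnW // -[LHS]mulr_natl natrB; last first.
  by apply: leq_expn; rewrite leq_pexp2l ?q_gt0 // leq_sub2l.
congr (_ * _); rewrite !natrX mulrBl mul1r; congr (_ - _).
rewrite -[in RHS](subnSK jk) [X in _ = _ * X ^+ _]exprS exprMn mulKf //.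
exact: qq_neq0.
Qed.

Lemma primitive_red k m (mk : (m <= k)%N) n (v : 'rV[R k]_n) : (0 < m)%N ->
  primitive (map_mx (red mk) v) = primitive v.
Proof.
move=> m0; apply/idP/idP => [|/primitiveP[u vu]]; last first.
  by apply/primitiveP; exists (map_mx (red mk) u); rewrite -map_mxM vu map_mx1.
have [//|[w ->]] := primitive_or v => pw.
have [] := primitive_excl (w := map_mx (red mk) w) m0 pw.
by rewrite map_mxZ /= red_unif.
Qed.

(** * Sums over pairs with primitive first vector *)

Section Join.
Variables (n1 n2 : nat) (G1 : graph n1) (G2 : graph n2).
Hypotheses (G1l : loopless G1) (G2l : loopless G2).
Local Notation join := (graph_join G1 G2).

(** Combines [card_altspan_join] with [card_altspan_cperp] for c = pi^m; the case m = k is the zero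
    second vector. *)
Lemma card_join_inv k m (mk : (m <= k)%N) (v1 : 'rV[R k]_n1) (w : 'rV[R k]_n2) :
  primitive v1 -> primitive w \/ m = k ->
  (#|altspan join (row_mx v1 (unif k ^+ m *: w))|%:R)^-1 =
  qq ^+ (k - m) / ((qq ^+ k) ^+ n2 * (qq ^+ (k - m)) ^+ n1)
    * (#|altspan G1 (map_mx (red mk) v1)|%:R)^-1 :> rat.
Proof.
move=> pv1 wmk; rewrite card_altspan_join //; last first.
  by case: wmk => [|->]; [left|right; rewrite unif_exp].
have := card_altspan_cperp (red_surj mk) (red_ker mk) G1l pv1.
rewrite card_multset // card_R; set M := #|_| => /(congr1 (fun i => i%:R : rat)).
rewrite !natrM !natrX => ME.
have q0 := qq_neq0.
have I0 : (#|altspan G1 (map_mx (red mk) v1)|%:R : rat) != 0.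
  by rewrite pnatr_eq0 -lt0n; apply/card_gt0P; exists 0; exact: altspan0.
have {ME} -> : (M%:R : rat) = (qq ^+ (k - m)) ^+ n1
    * #|altspan G1 (map_mx (red mk) v1)|%:R / qq ^+ (k - m).
  by apply: (canRL (mulfK _)).
by rewrite !invfM invrK; ring.
Qed.

Lemma sum_primitive_red k m (mk : (m <= k)%N) : (0 < m)%N ->
  \sum_(v : 'rV[R k]_n1 | primitive v)
     (#|altspan G1 (map_mx (red mk) v)|%:R)^-1
  = (qq ^+ (k - m)) ^+ n1 * alpha_prim (R m) G1.
Proof.
move=> m0; rewrite /alpha_prim big_mkcond [X in _ * X]big_mkcond /=.
have := sum_map_rV (red_surj mk) (red_ker mk)
  (fun w : 'rV_n1 => if primitive w then (#|altspan G1 w|%:R)^-1 else 0 : rat).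
rewrite card_multset // !natrX => <-.
by apply: eq_bigr => v _; rewrite /= primitive_red.
Qed.

(** Contribution of the pairs whose second vector, of length n, is not primitive: the summand m
    comes from second vectors generating (pi^m), the last term from the zero vector. *)
Definition join_tail (n : nat) (f : nat -> rat) (k : nat) : rat :=
  \sum_(1 <= m < k) (1 - qq ^- n) * qq ^+ (k - m) * (qq ^- n) ^+ m * f m
  + (qq ^- n) ^+ k * f k.

Lemma sum_primitive_layer k : (0 < k)%N ->
  \sum_(v1 : 'rV[R k]_n1 | primitive v1) \sum_(v2 in layer k n2 1)
     (#|altspan join (row_mx v1 v2)|%:R)^-1
  = join_tail n2 (fun m => alpha_prim (R m) G1) k.
Proof.
(* Reducing v1 modulo pi^m requires a proof of m <= k; the default 0 is never reached in the
   sums. *)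
move=> k0; pose h (v1 : 'rV[R k]_n1) m : rat := match boolP (m <= k)%N with
  | AltTrue mk => qq ^+ (k - m) / ((qq ^+ k) ^+ n2 * (qq ^+ (k - m)) ^+ n1)
    * (#|altspan G1 (map_mx (red mk) v1)|%:R)^-1
  | AltFalse _ => 0
  end.
have hE v1 m (mk : (m <= k)%N) :
    h v1 m = qq ^+ (k - m) / ((qq ^+ k) ^+ n2 * (qq ^+ (k - m)) ^+ n1)
    * (#|altspan G1 (map_mx (red mk) v1)|%:R)^-1.
  rewrite /h; case: {-}_ / boolP => mk'; last by rewrite mk in mk'.
  by rewrite (bool_irrelevance mk mk').
have hsum m (mk : (m <= k)%N) : (0 < m)%N ->
    \sum_(v1 : 'rV[R k]_n1 | primitive v1) h v1 m
    = qq ^+ (k - m) / (qq ^+ k) ^+ n2 * alpha_prim (R m) G1.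
  move=> m0; under eq_bigr => v _ do rewrite (hE v m mk).
  rewrite -mulr_sumr sum_primitive_red // invfM !mulrA; congr (_ * _).
  by rewrite divfK // expf_neq0 // qq_neq0.
rewrite (eq_bigr (fun v1 => \sum_(1 <= m < k)
   (1 - qq ^- n2) * (qq ^+ (k - m)) ^+ n2 * h v1 m + h v1 k)) => [|v1 pv1]; last first.
  apply: sum_layer => // [m w mk pw|].
    by rewrite (card_join_inv (ltnW mk)) ?(hE _ _ (ltnW mk)) //; left.
  have := card_join_inv (w := 0) (leqnn k) pv1 (or_intror erefl).
  by rewrite scaler0 => ->; rewrite -hE.
rewrite big_split exchange_big /= /join_tail; congr (_ + _); last first.
  rewrite hsum // subnn expr0 mul1r; congr (_ * _).
  by rewrite exprVn -!exprM mulnC.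
rewrite big_nat_cond [RHS]big_nat_cond; apply: eq_bigr => m /andP[/andP[m0 mk] _].
rewrite -mulr_sumr (hsum m (ltnW mk) m0) -!mulrA; congr (_ * _); rewrite mulrCA; congr (_ * _).
rewrite !mulrA; congr (_ * _).
(* The number of second vectors, of order q^((k-m) n2), against the index q^(k n2) leaves the weight
   q^(-n2 m). *)
rewrite exprVn -!exprM -{2}(subnK (ltnW mk)) mulnDl exprD invfM mulrA [(n2 * m)%N]mulnC.
by rewrite mulfV ?mul1r // qq_neq0.
Qed.

(** Here m = 0, so the reduced span lives over the zero ring and has one element. All summands are
    equal, and only the primitive pairs have to be counted. *)
Lemma sum_primitive_both k : (0 < k)%N ->
  \sum_(v1 : 'rV[R k]_n1 | primitive v1) \sum_(v2 : 'rV[R k]_n2 | primitive v2)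
     (#|altspan join (row_mx v1 v2)|%:R)^-1
  = qq ^+ k * (1 - qq ^- n1) * (1 - qq ^- n2).
Proof.
move=> k0; have card_prim n : (#|[pred v : 'rV[R k]_n | primitive v]|%:R : rat)
    = (qq ^+ k) ^+ n * (1 - qq ^- n).
  rewrite (eq_card (B := ~: layer k n 1)) => [|v]; last first.
    by rewrite [RHS]finset.in_setC -primitive_layer.
  rewrite cardsCs finset.setCK card_mx mul1n card_R card_layer // natrB; last first.
    by apply: leq_expn; rewrite leq_pexp2l ?q_gt0 // leq_subr.
  rewrite !natrX mulrBr mulr1; congr (_ - _).
  rewrite subn1 -[in RHS](prednK k0) exprS exprMn mulrAC mulfV ?mul1r //.
  exact: qq_neq0.
pose e : rat := qq ^+ k / ((qq ^+ k) ^+ n2 * (qq ^+ k) ^+ n1).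
rewrite (eq_bigr (fun=> (qq ^+ k) ^+ n2 * (1 - qq ^- n2) * e)) => [|v1 pv1].
  rewrite sumr_const -[LHS]mulr_natl card_prim /e.
  have k1 : (qq ^+ k) ^+ n1 != 0 by rewrite expf_neq0 // qq_neq0.
  have k2 : (qq ^+ k) ^+ n2 != 0 by rewrite expf_neq0 // qq_neq0.
  move: (qq ^- n1) (qq ^- n2) k1 k2 => z1 z2 k1 k2; by field; rewrite k1 k2.
rewrite (eq_bigr (fun=> e)) => [|v2 pv2].
  by rewrite sumr_const -[LHS]mulr_natl card_prim.
have := card_join_inv (leq0n k) pv1 (or_introl pv2).
rewrite expr0 scale1r subn0 => ->; rewrite -[RHS]mulr1; congr (_ * _).
have -> : altspan G1 (map_mx (red (leq0n k)) v1) = [set 0].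
  apply/setP => x; rewrite inE; have -> : x = 0.
    by apply/rowP => i; rewrite mxE; exact: R0_eq0.
  by rewrite altspan0 eqxx.
by rewrite cards1 invr1.
Qed.

End Join.


(** * From primitive vectors to all vectors *)

Section Recursion.
Variables (n : nat) (G : graph n).
Hypothesis Gl : loopless G.

Lemma alpha0 : alpha (R 0) G = 1.
Proof.
have R00 (x : 'rV[R 0]_n) : x = 0.
  by apply/rowP => i; rewrite mxE; exact: R0_eq0.
rewrite /alpha (bigD1 0) //= big1 => [|v]; last by rewrite (R00 v) eqxx.
have -> : altspan G (0 : 'rV[R 0]_n) = [set 0].
  by apply/setP => x; rewrite inE (R00 x) altspan0 eqxx.
by rewrite cards1 invr1 addr0.
Qed.

(** The nonprimitive vectors at level k+1 are the multiples pi v with v at level k, and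
    [card_altspan_scale] shows that their spans have the same size. *)
Lemma alphaS k : alpha (R k.+1) G = alpha (R k) G + alpha_prim (R k.+1) G.
Proof.
rewrite /alpha (bigID (fun v : 'rV[R k.+1]_n => primitive v)) /= addrC; congr (_ + _).
have inj : injective (map_mx (@up k) : 'rV_n -> 'rV_n).
  move=> x y /matrixP xy; apply/matrixP => i j.
  by apply: up_inj; have := xy i j; rewrite !mxE.
have upE (v : 'rV[R k.+1]_n) : map_mx (@up k) (map_mx (red (leqnSn k)) v) = unif k.+1 *: v.
  by apply/matrixP => i j; rewrite !mxE up_red.
rewrite (eq_bigl (mem [set map_mx (@up k) w | w : 'rV[R k]_n])) => [|v]; last first.
  rewrite primitive_layer // negbK; apply/layerP/imsetP => -[w].
    by rewrite expr1 => ->; exists (map_mx (red (leqnSn k)) w).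
  move=> _ ->; have [v' <-] := map_mx_surj (red_surj (leqnSn k)) w.
  by exists v'; rewrite expr1 upE.
rewrite big_imset /=; last by move=> x y _ _; exact: inj.
apply: eq_bigr => w _; have [v <-] := map_mx_surj (red_surj (leqnSn k)) w.
by rewrite upE (card_altspan_scale (red_surj (leqnSn k)) v Gl (@up_inj k) (@up_red k)).
Qed.

Lemma dif_alpha k : dif (fun i => alpha (R i) G) k.+1 = alpha_prim (R k.+1) G.
Proof. by rewrite /dif /= alphaS addrAC subrr add0r. Qed.

End Recursion.

Lemma join_tail1 n f : join_tail n f 1 = qq ^- n * f 1%N.
Proof. by rewrite /join_tail big_geq // add0r. Qed.

(** The sum is geometric in k. Multiplying by q gives the term m = k without its factor 1 - q^-n,
    which accounts for the correction -q f(k). *)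
Lemma join_tailS n f k : (0 < k)%N -> join_tail n f k.+1 =
  qq * join_tail n f k + (qq ^- n) ^+ k.+1 * (f k.+1 - qq * f k).
Proof.
move=> k0; rewrite /join_tail big_nat_recr //= subSnn expr1.
have -> : \sum_(1 <= m < k) (1 - qq ^- n) * qq ^+ (k.+1 - m) * (qq ^- n) ^+ m * f m
    = qq * \sum_(1 <= m < k) (1 - qq ^- n) * qq ^+ (k - m) * (qq ^- n) ^+ m * f m.
  rewrite mulr_sumr big_nat_cond [RHS]big_nat_cond.
  apply: eq_bigr => m /andP[/andP[_ /ltnW mk] _].
  by rewrite subSn // exprS; move: (qq ^- n) => z; ring.
by rewrite exprS; move: (qq ^- n) => z; move: (\sum_(_ <= _ < _) _) => s; ring.
Qed.

(** * The primitive sum of a join *)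

Section Combine.
Variables (n1 n2 : nat) (G1 : graph n1) (G2 : graph n2).
Hypotheses (G1l : loopless G1) (G2l : loopless G2).
Local Notation join := (graph_join G1 G2).

Lemma primitive_row_mx k (v1 : 'rV[R k]_n1) (v2 : 'rV[R k]_n2) : (0 < k)%N ->
  primitive (row_mx v1 v2) = primitive v1 || primitive v2.
Proof.
move=> k0; apply/idP/orP => [pv|[] /primitiveP[u vu]]; first last.
- by apply/primitiveP; exists (col_mx 0 u); rewrite mul_row_col mulmx0 add0r.
- by apply/primitiveP; exists (col_mx u 0); rewrite mul_row_col mulmx0 addr0.
have [|[w1 v1E]] := primitive_or v1; first by left.
have [|[w2 v2E]] := primitive_or v2; first by right.
have [] := primitive_excl (w := row_mx w1 w2) k0 pv.
by rewrite scale_row_mx -v1E -v2E.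
Qed.

(** A pair is primitive when both parts are, or only the first, or only the second; these cases give
    the three terms. *)
Lemma alpha_prim_join k : (0 < k)%N -> alpha_prim (R k) join =
  qq ^+ k * (1 - qq ^- n1) * (1 - qq ^- n2)
  + join_tail n2 (fun m => alpha_prim (R m) G1) k
  + join_tail n1 (fun m => alpha_prim (R m) G2) k.
Proof.
move=> k0; rewrite -(sum_primitive_both G1l G2l k0).
rewrite -(sum_primitive_layer G1l G2l k0) -(sum_primitive_layer G2l G1l k0).
rewrite /alpha_prim (reindex (fun p : 'rV[R k]_n1 * 'rV[R k]_n2 => row_mx p.1 p.2)) /=; last first.
  exists (fun v => (lsubmx v, rsubmx v)) => [[x y] _|v _] /=.
    by rewrite row_mxKl row_mxKr.
  exact: hsubmxK.
rewrite -(pair_big_dep predT (fun v1 v2 => primitive (row_mx v1 v2))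
  (fun v1 v2 => (#|altspan join (row_mx v1 v2)|%:R)^-1)) /=.
rewrite (bigID (fun v1 : 'rV[R k]_n1 => primitive v1)) /=; congr (_ + _).
  rewrite -big_split; apply: eq_bigr => v1 pv1 /=.
  rewrite (bigID (fun v2 : 'rV[R k]_n2 => primitive v2)) /=; congr (_ + _);
    apply: eq_bigl => v2; rewrite primitive_row_mx // pv1 //=.
  by rewrite primitive_layer // negbK.
(* The last term was computed for the join in the other order. *)
under [RHS]eq_bigr => v2 _ do under eq_bigr => v1 _ do rewrite card_altspan_swap.
rewrite [RHS]exchange_big /=.
rewrite (eq_bigl (mem (layer k n1 1))) => [|v1]; last first.
  by rewrite primitive_layer // negbK.
apply: eq_bigr => v1 v1l; apply: eq_bigl => v2.
have {}v1l : v1 \in layer k n1 1 by [].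
by rewrite primitive_row_mx // (primitive_layer v1) // v1l.
Qed.

End Combine.

End Tower.

Theorem theoremA (n1 n2 : nat) (G1 : graph n1) (G2 : graph n2)
    (W1 W2 : ratXT) :
  loopless G1 -> loopless G2 ->
  is_Wminus G1 W1 -> is_Wminus G2 W2 ->
  let z1 : ratXT := fX ^- n1 in
  let z2 : ratXT := fX ^- n2 in
  is_Wminus (graph_join G1 G2)
    ((z1 * z2 * fX * fT - 1
      + substXT W1 fX (z2 * fT) * (1 - z2 * fT) * (1 - z2 * fX * fT)
      + substXT W2 fX (z1 * fT) * (1 - z1 * fT) * (1 - z1 * fX * fT))
     / ((1 - fT) * (1 - fX * fT))).
Proof.
(* Uniqueness comes from [G1]; what remains is the expansion at one compact DVR. *)
move=> G1l G2l W1P W2P z1 z2; apply: (is_Wminus_uniq W1P) => O pi Opi.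
have [[_ pi0 unitE] cO] := Opi.
pose fin k : finite_set [set: residue (pi ^+ k)]%classic := compact_finite_residue k cO.
have qE : #|` fset_set [set: residue pi]%classic| = #|{: finres (fin 1%N)}|.
  by rewrite -card_fset_setT.
have Jl := graph_join_loopless G1l G2l.
have askE n (G : graph n) (Gl : loopless G) :
    ask_zeta pi (Aminus_over O G) =1 (fun k => alpha (finres (fin k)) G).
  by move=> k; exact: ask_alpha.
apply: (eq_expansion (fsym (askE _ _ Jl))); rewrite qE.
have EW1 := eq_expansion (askE _ _ G1l) (W1P.1 _ _ Opi).
have EW2 := eq_expansion (askE _ _ G2l) (W2P.1 _ _ Opi).
rewrite qE in EW1 EW2.
apply: (expansion_join (q_gt0 fin) EW1 EW2); rewrite ?alpha0 //.
  rewrite !(dif_alpha fin pi0 unitE) // (alpha_prim_join fin pi0 unitE G1l G2l) //.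
  by rewrite !join_tail1 expr1; ring.
(* Both tails and q^(k+1) (1 - z1) (1 - z2) are multiplied by q when k grows by one; the corrections
   in [join_tailS] are the remaining terms of the recursion. *)
move=> k; rewrite !(dif_alpha fin pi0 unitE) // !(alpha_prim_join fin pi0 unitE G1l G2l) //.
rewrite !(join_tailS _ _ _ (ltn0Sn k)) [_ ^+ k.+2]exprS.
move: (_ ^+ k.+2 * _) (_ ^+ k.+2 * _) (join_tail _ n1 _ _) (join_tail _ n2 _ _) => x y s t.
by move: (_ ^+ k.+1) (_ ^- n1) (_ ^- n2) => u z w; ring.
Qed.
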